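(* Let $X,Y$ be Banach spaces, let $K$ be a compact Hausdorff topological space and let $G\in L(X,Y)$ be a norm-one operator. Consider the norm-one composition operator $\widetilde{G}:C(K,X)\to C(K,Y)$ given by $\widetilde{G}(f)=G\circ f$ for every $f\in C(K,X)$. Then: (a) $\widetilde{G}$ is a spear operator if and only if $G$ is a spear operator. (b) $\widetilde{G}$ is lush if and only if $G$ is lush. (c) If $K$ contains isolated points, then $\widetilde{G}$ has the alternative Daugavet property if and only if $G$ does. (d) If $K$ is perfect, then $\widetilde{G}$ has the alternative Daugavet property if and only if $G(B_X)$ is a spear set of $Y$.
   Context: Scalars are $\mathbb{K}=\mathbb{R}$ or $\mathbb{C}$; $\mathbb{T}=\{\omega\in\mathbb{K}:|\omega|=1\}$; $B_X$, $S_X$ are the closed unit ball and unit sphere; $\operatorname{aconv}(F)=\operatorname{conv}(\mathbb{T}F)$. $C(K,X)$ is the Banach space of continuous functions $K\to X$ with the sup norm ($K$ nonempty). $K$ is perfect if it has no isolated points. $G\in L(X,Y)$ is a spear operator if $\sup_{\omega\in\mathbb{T}}\|G+\omega T\|=1+\|T\|$ for every $T\in L(X,Y)$; it has the alternative Daugavet property if this holds for every rank-one $T\in L(X,Y)$. A norm-one $G\in L(X,Y)$ is lush if for every $x_0\in B_X$, $\varepsilon>0$ and $y\in S_Y$ there is $F\subset B_X$ with $\operatorname{conv}(F)\subset\{x\in B_X:\|Gx+y\|>2-\varepsilon\}$ and $\operatorname{dist}(x_0,\operatorname{aconv}(F))<\varepsilon$. A set $F\subset B_Y$ is a spear set of $Y$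 if $\sup\{\|f+\omega y\|:f\in F,\ \omega\in\mathbb{T}\}=1+\|y\|$ for every $y\in Y$. *)

(* Defs.v *)
From HB Require Import structures.
From mathcomp Require Import all_boot all_order all_algebra.
From mathcomp Require Import complex.
From mathcomp Require Import boolp classical_sets functions reals.
From mathcomp Require Import constructive_ereal ereal topology normedtype.

Set Implicit Arguments.
Unset Strict Implicit.
Unset Printing Implicit Defensive.

Import Order.TTheory GRing.Theory Num.Theory.
Import numFieldNormedType.Exports.

Local Open Scope classical_set_scope.
Local Open Scope ring_scope.

(* Suprema and infima are taken with [supremum] and [infimum] in the partial
   order of the scalar field, because norms of an [F]-normed module take their
   values in [F].  For F = R[i] the order is [0 <= y - x] in the sense "real
   and nonnegative", so the least upper bound in F of a nonempty bounded set of
   real elements is its real supremum. *)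

(* C(K, X): the compactness proof is a parameter of the type because it is
   what makes the sup norm finite. *)
Definition cfun (F : numFieldType) (K : topologicalType)
    (cK : compact [set: K]) (X : normedModType F) : Type :=
  continuousType K X.

Section cfun_lmodule.
Context (F : numFieldType) (K : topologicalType) (cK : compact [set: K]).
Context (X : normedModType F).
Local Notation C := (cfun cK X).

HB.instance Definition _ := Choice.on C.

Lemma cfunP (f g : C) : (forall t, f t = g t) -> f = g.
Proof. by move=> fg; apply/continuousEP. Qed.

Lemma cfun_continuous (f : C) : continuous (f : K -> X).
Proof. exact: cts_fun. Qed.

Definition mkcfun (f : K -> X) (cf : continuous f) : C :=
  (mkcts cf : continuousType K X).

Lemma cfun_zero_subproof : continuous (fun _ : K => 0 : X).
Proof. by move=> t; exact: cvg_cst. Qed.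

Lemma cfun_opp_subproof (f : C) : continuous (fun t => - f t).
Proof. by move=> t; apply: cvgN; exact: cfun_continuous. Qed.

Lemma cfun_add_subproof (f g : C) : continuous (fun t => f t + g t).
Proof. by move=> t; apply: cvgD; exact: cfun_continuous. Qed.

Lemma cfun_scale_subproof (a : F) (f : C) : continuous (fun t => a *: f t).
Proof. by move=> t; apply: cvgZr; exact: cfun_continuous. Qed.

Definition cfun_zero : C := mkcfun cfun_zero_subproof.
Definition cfun_opp (f : C) : C := mkcfun (@cfun_opp_subproof f).
Definition cfun_add (f g : C) : C := mkcfun (@cfun_add_subproof f g).
Definition cfun_scale (a : F) (f : C) : C := mkcfun (@cfun_scale_subproof a f).

Fact cfun_addA : associative cfun_add.
Proof. by move=> f g h; apply: cfunP => t; exact: addrA. Qed.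

Fact cfun_addC : commutative cfun_add.
Proof. by move=> f g; apply: cfunP => t; exact: addrC. Qed.

Fact cfun_add0 : left_id cfun_zero cfun_add.
Proof. by move=> f; apply: cfunP => t; exact: add0r. Qed.

Fact cfun_addN : left_inverse cfun_zero cfun_opp cfun_add.
Proof. by move=> f; apply: cfunP => t; exact: addNr. Qed.

HB.instance Definition _ :=
  GRing.isZmodule.Build C cfun_addA cfun_addC cfun_add0 cfun_addN.

Fact cfun_scaleA a b f : cfun_scale a (cfun_scale b f) = cfun_scale (a * b) f.
Proof. by apply: cfunP => t; exact: scalerA. Qed.

Fact cfun_scale1 : left_id 1 cfun_scale.
Proof. by move=> f; apply: cfunP => t; exact: scale1r. Qed.

Fact cfun_scaleDr : right_distributive cfun_scale +%R.
Proof. by move=> a f g; apply: cfunP => t; exact: scalerDr. Qed.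

Fact cfun_scaleDl f : {morph cfun_scale^~ f : a b / a + b}.
Proof. by move=> a b; apply: cfunP => t; exact: scalerDl. Qed.

HB.instance Definition _ := GRing.Zmodule_isLmodule.Build F C
  cfun_scaleA cfun_scale1 cfun_scaleDr cfun_scaleDl.

Lemma cfun0E t : (0 : C) t = 0. Proof. by []. Qed.
Lemma cfunNE (f : C) t : (- f) t = - f t. Proof. by []. Qed.
Lemma cfunDE (f g : C) t : (f + g) t = f t + g t. Proof. by []. Qed.
Lemma cfunBE (f g : C) t : (f - g) t = f t - g t. Proof. by []. Qed.
Lemma cfunZE a (f : C) t : (a *: f) t = a *: f t. Proof. by []. Qed.

End cfun_lmodule.

Section cfun_norm.
Context (F : numFieldType) (K : topologicalType) (cK : compact [set: K]).
Context (X : normedModType F).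
Local Notation C := (cfun cK X).

Definition cfun_norm (f : C) : F := supremum 0 [set `|f t| | t in [set: K]].

Lemma cfun_norm_max (f : C) (t0 : K) :
  exists2 s, cfun_norm f = `|f s| & forall t, `|f t| <= `|f s|.
Proof.
have [s smax] : exists s, forall t, `|f t| <= `|f s|.
  pose above s := [set a | `|f s| <= `|f a|].
  have Fp : ProperFilter (filter_from [set: K] above).
    apply: filter_from_proper => [|s _]; last by exists s; rewrite /above/=.
    apply: filter_from_filter; first by exists t0.
    move=> s u _ _.
    have [us|su] := real_leP (normr_real (f u)) (normr_real (f s)).
      by exists s => // a sa; split => //; exact: le_trans us sa.
    by exists u => // a ua; split => //; exact: le_trans (ltW su) ua.
  have FT : filter_from [set: K] above [set: K] by exists t0.
  have [p [_ pcl]] := cK Fp FT.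
  exists p; apply: contrapT => /existsNP[t /negP].
  rewrite -real_ltNge ?normr_real// => pt.
  have e0 : 0 < `|f t| - `|f p| by rewrite subr_gt0.
  have := @cfun_continuous F K cK X f p.
  move=> /cvgrPdist_lt /(_ _ e0) Up.
  have Ft : filter_from [set: K] above (above t) by exists t.
  have [u [tu /=]] := pcl _ _ Ft Up.
  rewrite distrC ltrBrDr => up.
  have := lt_le_trans (le_lt_trans (ler_normD (f u - f p) (f p)) up) tu.
  by rewrite subrK ltxx.
exists s => //; rewrite /cfun_norm /supremum ifF; last first.
  by apply/negbTE/set0P; exists `|f s|; exists s.
have smaxs : supremums [set `|f t| | t in [set: K]] `|f s|.
  split; first by move=> _ [t _ <-].
  by move=> y; apply; exists s.
case: xgetP => [y _ ys|/(_ `|f s|)//].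
exact: (is_subset1_supremums ys smaxs).
Qed.

Lemma cfun_norm_ge (f : C) t : `|f t| <= cfun_norm f.
Proof. by have [s ->] := cfun_norm_max f t. Qed.

Lemma cfun_norm0 (f : C) : [set: K] = set0 -> cfun_norm f = 0.
Proof. by move=> K0; rewrite /cfun_norm K0 image_set0 supremum0. Qed.

Lemma cfun_norm_le (f : C) (m : F) :
  0 <= m -> (forall t, `|f t| <= m) -> cfun_norm f <= m.
Proof.
move=> m0 fm; have [K0|/set0P[t0 _]] := eqVneq [set: K] set0.
  by rewrite cfun_norm0.
by have [s -> _] := cfun_norm_max f t0.
Qed.

Lemma cfun_norm_ge0 (f : C) : 0 <= cfun_norm f.
Proof.
have [K0|/set0P[t0 _]] := eqVneq [set: K] set0; first by rewrite cfun_norm0.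
exact: le_trans (normr_ge0 _) (cfun_norm_ge f t0).
Qed.

Fact cfun_norm_ler_normD (f g : C) :
  cfun_norm (f + g) <= cfun_norm f + cfun_norm g.
Proof.
apply: cfun_norm_le; first by rewrite addr_ge0 ?cfun_norm_ge0.
move=> t; rewrite cfunDE (le_trans (ler_normD _ _))//.
by rewrite lerD ?cfun_norm_ge.
Qed.

Fact cfun_normZ (a : F) (f : C) : cfun_norm (a *: f) = `|a| * cfun_norm f.
Proof.
have [K0|/set0P[t0 _]] := eqVneq [set: K] set0.
  by rewrite !cfun_norm0 ?mulr0.
apply/eqP; rewrite eq_le; apply/andP; split.
  apply: cfun_norm_le; first by rewrite mulr_ge0 ?cfun_norm_ge0.
  by move=> t; rewrite cfunZE normrZ ler_wpM2l ?cfun_norm_ge.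
have [s -> _] := cfun_norm_max f t0.
by rewrite -normrZ -cfunZE cfun_norm_ge.
Qed.

Fact cfun_norm_eq0 (f : C) : cfun_norm f = 0 -> f = 0.
Proof.
move=> f0; apply: cfunP => t; apply/eqP; rewrite -normr_le0 -f0.
exact: cfun_norm_ge.
Qed.

HB.instance Definition _ := Lmodule_isNormed.Build F C
  cfun_norm_ler_normD cfun_normZ cfun_norm_eq0.

Lemma cfun_normE (f : C) : `|f| = cfun_norm f. Proof. by []. Qed.

End cfun_norm.

Section cfun_complete.
Context (F : numFieldType) (K : topologicalType) (cK : compact [set: K]).
Context (X : completeNormedModType F).
Local Notation C := (cfun cK X).

Fact cfun_cauchy_cvg (G : set_system C) :
  ProperFilter G -> cauchy G -> cvg G.
Proof.
move=> PG cG.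
have small e : 0 < e -> exists2 A, G A & forall f g, A f -> A g -> `|f - g| < e.
  move=> e0; have e20 : 0 < e / 2 by rewrite divr_gt0.
  have /cauchyP cG' := cG; have [f0 Gf0] := cG' _ e20.
  exists (ball f0 (e / 2)) => // f g; rewrite -ball_normE /= => f0f f0g.
  rewrite -(subrKA f0) (splitr e) (le_lt_trans (ler_normD _ _))//.
  by rewrite ltrD// distrC.
pose ev t (f : C) := f t.
have cev t : cvg (ev t @ G).
  apply: cauchy_cvg; apply/cauchy_exP => e e0.
  have [A GA Ae] := small e e0.
  have [f Af] := filter_ex GA.
  exists (f t); rewrite nbhs_simpl /=; apply: filterS GA => g Ag.
  rewrite -ball_normE /= /ev -cfunBE.
  exact: le_lt_trans (cfun_norm_ge _ _) (Ae _ _ Af Ag).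
pose h t := lim (ev t @ G).
have unif e : 0 < e -> exists2 A, G A & forall f t, A f -> `|h t - f t| <= e.
  move=> e0; have [A GA Ae] := small e e0; exists A => // f t Af.
  have GF : ProperFilter (ev t @ G) by exact: fmap_proper_filter.
  apply/ler_addgt0Pr => d d0.
  have FG : Filter G by exact: filter_filter.
  have near_h := @cvgr_dist_lt _ _ _ G FG (ev t) _ (cev t) d d0.
  have [g [Ag hg]] := filter_ex (filterI GA near_h).
  rewrite [leRHS]addrC -(subrKA (g t)) (le_trans (ler_normD _ _))// lerD//.
    exact: ltW.
  by rewrite -cfunBE (le_trans (cfun_norm_ge _ _))// ltW// Ae.
have hc : continuous h.
  move=> t; apply/cvgrPdist_lt => e e0.
  have e30 : 0 < e / 3 by rewrite divr_gt0.
  have [A GA hA] := unif _ e30.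
  have [f Af] := filter_ex GA.
  have := @cfun_continuous F K cK X f t.
  move=> /cvgrPdist_lt /(_ _ e30); apply: filterS => u ftu.
  have -> : h t - h u = (h t - f t) + (f t - f u) + (f u - h u).
    by rewrite !addrA subrK subrK.
  have -> : e = e / 3 + e / 3 + e / 3.
    rewrite -!mulrDl [X in X / 3](_ : _ = e * 3) ?mulfK ?pnatr_eq0//.
    by rewrite mulr_natr !mulrS mulr0n addr0 addrA.
  rewrite (le_lt_trans (ler_normD _ _))// ltr_leD//; last first.
    by rewrite distrC hA.
  by rewrite (le_lt_trans (ler_normD _ _))// ler_ltD// hA.
apply/cvg_ex; exists (mkcfun cK hc); apply/cvgrPdist_le => e e0.
have [A GA hA] := unif _ e0.
near=> f; apply: cfun_norm_le; first exact: ltW.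
by move=> t; rewrite cfunBE; apply: hA; near: f.
Unshelve. all: by end_near. Qed.

HB.instance Definition _ := Uniform_isComplete.Build C cfun_cauchy_cvg.

End cfun_complete.

Section notions.
Context (F : numFieldType).
Implicit Types X Y : normedModType F.

Definition unit_scalars : set F := [set w | `|w| = 1].

Definition unit_ball X : set X := [set x | `|x| <= 1].

Definition unit_sphere X : set X := [set x | `|x| = 1].

Arguments unit_ball X _ : clear implicits.
Arguments unit_sphere X _ : clear implicits.

Definition conv_hull X (A : set X) : set X :=
  [set v | exists n (c : 'I_n -> F) (a : 'I_n -> X),
    [/\ forall i, 0 <= c i, \sum_i c i = 1, forall i, A (a i)
      & v = \sum_i c i *: a i]].

Definition aconv_hull X (A : set X) : set X :=
  conv_hull [set w *: x | w in unit_scalars & x in A].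

(* +oo when A is empty *)
Definition dist X (x : X) (A : set X) : \bar F :=
  infimum +oo%E [set (`|x - a|)%:E | a in A].

Definition opnorm X Y (T : X -> Y) : F :=
  supremum 0 [set `|T x| | x in unit_ball X].

Definition spear_equation X Y (G T : X -> Y) : Prop :=
  supremum 0 [set opnorm (fun x => G x + w *: T x) | w in unit_scalars]
    = 1 + opnorm T.

Definition spear_operator X Y (G : {linear X -> Y}) : Prop :=
  forall T : {linear X -> Y}, continuous T -> spear_equation G T.

Definition rank_one X Y (T : {linear X -> Y}) : Prop :=
  exists2 y : Y, y != 0 & range T = [set a *: y | a in [set: F]].

Definition alternative_Daugavet X Y (G : {linear X -> Y}) : Prop :=
  forall T : {linear X -> Y}, continuous T -> rank_one T ->
    spear_equation G T.

Definition lush X Y (G : {linear X -> Y}) : Prop :=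
  opnorm G = 1 /\
  forall (x0 : X) (e : F) (y : Y), unit_ball X x0 -> 0 < e -> unit_sphere Y y ->
    exists A : set X,
      [/\ A `<=` unit_ball X,
          conv_hull A `<=` [set x | unit_ball X x /\ 2 - e < `|G x + y|]
        & (dist x0 (aconv_hull A) < e%:E)%E].

Definition spear_set Y (A : set Y) : Prop :=
  A `<=` unit_ball Y /\
  forall y : Y,
    supremum 0 [set `|f + w *: y| | f in A & w in unit_scalars] = 1 + `|y|.

End notions.
Arguments unit_ball {F} X _.
Arguments unit_sphere {F} X _.

Section composition_operator.
Context (F : numFieldType) (K : topologicalType) (cK : compact [set: K]).
Context (X Y : normedModType F) (G : {linear X -> Y}).
Hypothesis cG : continuous G.

Lemma comp_op_subproof (f : cfun cK X) : continuous (G \o f).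
Proof.
by move=> t; apply: continuous_comp; [exact: cfun_continuous | exact: cG].
Qed.

Definition comp_op (f : cfun cK X) : cfun cK Y :=
  mkcfun cK (@comp_op_subproof f).

Lemma comp_opE (f : cfun cK X) (t : K) : comp_op f t = G (f t).
Proof. by []. Qed.

Fact comp_op_is_linear : linear comp_op.
Proof.
by move=> a f g; apply: cfunP => t; rewrite comp_opE !cfunDE !cfunZE linearP.
Qed.

HB.instance Definition _ := GRing.isLinear.Build F (cfun cK X) (cfun cK Y) _
  comp_op comp_op_is_linear.

End composition_operator.
Arguments comp_op {F K} cK {X Y G} cG f.

Section composition_operator_facts.
Context (F : numFieldType) (K : topologicalType) (cK : compact [set: K]).
Context (X Y : normedModType F) (G : {linear X -> Y}) (cG : continuous G).

Lemma comp_op_continuous : continuous (comp_op cK cG).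
Proof.
apply: bounded_linear_continuous; apply/linear_boundedP.
have := (linear_boundedP G).1 (continuous_linear_bounded 0 (@cG 0)).
move=> bG; near=> r => f.
have r0 : 0 <= r by near: r; exact: nbhs_pinfty_ge.
have bGr : forall x, `|G x| <= r * `|x| by near: r.
apply: cfun_norm_le; first by rewrite mulr_ge0.
by move=> t; rewrite comp_opE (le_trans (bGr _))// ler_wpM2l ?cfun_norm_ge.
Unshelve. all: by end_near. Qed.

Lemma opnorm_comp_op : [set: K] !=set0 ->
  opnorm (comp_op cK cG) = opnorm G.
Proof.
move=> [t0 _]; rewrite /opnorm /supremum.
have nex (V W : normedModType F) (T : V -> W) :
    ([set `|T x| | x in unit_ball V] == set0) = false.
  apply/negbTE/set0P; exists `|T 0|; exists 0 => //.
  by rewrite /unit_ball /= normr0.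
rewrite !nex; congr (xget _ _); rewrite /supremums.
suff -> : ubound [set `|comp_op cK cG f| | f in unit_ball (cfun cK X)] =
          ubound [set `|G x| | x in unit_ball X] by [].
apply/seteqP; split=> m um _ [u u1 <-].
  have cu : continuous (fun _ : K => u) by move=> t; exact: cvg_cst.
  pose c : cfun cK X := mkcfun cK cu.
  have c1 : unit_ball (cfun cK X) c by apply: cfun_norm_le.
  apply: le_trans (um _ (ex_intro2 _ _ c c1 erefl)).
  exact: (cfun_norm_ge (comp_op cK cG c) t0).
have [s us _] := cfun_norm_max (comp_op cK cG u) t0.
rewrite cfun_normE us comp_opE; apply: um; exists (u s) => //.
exact: le_trans (cfun_norm_ge u s) u1.
Qed.

End composition_operator_facts.

(* Main.v *)
Require Import Defs.
From HB Require Import structures.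
From mathcomp Require Import all_boot all_order all_algebra.
From mathcomp Require Import complex.
From mathcomp Require Import boolp classical_sets functions reals.
From mathcomp Require Import constructive_ereal ereal topology normedtype.
From mathcomp Require Import lra ring.

Set Implicit Arguments.
Unset Strict Implicit.
Unset Printing Implicit Defensive.

Import Order.TTheory GRing.Theory Num.Theory.
Import numFieldNormedType.Exports.

Local Open Scope classical_set_scope.
Local Open Scope ring_scope.


(* A spear or Daugavet equation for an operator T on C(K, X) is reduced to one
   on X: T is nearly normed at some f0 and t0, the value f0(t0) lies between two
   opposite unit vectors, and freezing f0 away from t0 by a Urysohn function
   turns T into an operator from X to Y of almost the same norm.  For rank-one T
   on a perfect K one may instead modify f0 on a tiny open set where T hardly
   sees the change, because small open sets carrying mass would add up; then
   only the values of G on the ball matter, which is the spear set condition.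
   For lushness, the slice in the definition can be recovered by a norming
   functional from one convex combination, and this form of lushness passes
   between X and C(K, X) by evaluation at a point and by Urysohn functions. *)

(* Treats F = R and F = R[i] uniformly: [emb] embeds R into F, [re] is the real
   part, and j in the last field is an imaginary unit. *)
Record real_part (R : realType) (F : numFieldType) := RealPart {
  emb : {rmorphism R -> F};
  re : F -> R;
  reD : forall a b, re (a + b) = re a + re b;
  re_embM : forall a z, re (emb a * z) = a * re z;
  re_le : forall z, emb (re z) <= `|z|;
  re_real : forall z, z \is Num.real -> emb (re z) = z;
  le_emb : forall a b, (emb a <= emb b) = (a <= b);
  re_or_im : (forall z, emb (re z) = z) \/
    exists2 j : F, j * j = -1
      & forall z, z = emb (re z) - j * emb (re (j * z))
}.

(** * Scalars and real-valued norms *)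

Section scalars.
Context {R : realType} {F : numFieldType} (P : real_part R F).
Local Notation emb := (emb P).
Local Notation re := (re P).

Lemma re1 : re 1 = 1.
Proof. by apply: (fmorph_inj emb); rewrite re_real ?rmorph1 // real1. Qed.

Lemma re_emb a : re (emb a) = a.
Proof. by rewrite -[emb a]mulr1 re_embM re1 mulr1. Qed.

Lemma lt_emb a b : (emb a < emb b) = (a < b).
Proof. by rewrite !lt_neqAle le_emb (inj_eq (fmorph_inj emb)). Qed.

Lemma emb_ge0 a : (0 <= emb a) = (0 <= a).
Proof. by rewrite -(rmorph0 emb) le_emb. Qed.

Lemma emb_gt0 a : (0 < emb a) = (0 < a).
Proof. by rewrite -(rmorph0 emb) lt_emb. Qed.

Lemma emb_is_real a : emb a \is Num.real.
Proof.
have [a0|/ltW a0] := leP 0 a; first by apply: ger0_real; rewrite emb_ge0.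
by rewrite -rpredN -rmorphN; apply: ger0_real; rewrite emb_ge0 oppr_ge0.
Qed.

(** Moves norms from the partially ordered [F] into [R], where the order is total and linear
    arithmetic applies. *)
Definition nrm (V : normedZmodType F) (x : V) : R := re `|x|.

Lemma nrmE (V : normedZmodType F) (x : V) : emb (nrm x) = `|x|.
Proof. exact/re_real/normr_real. Qed.

Lemma nrm_le (V : normedZmodType F) (x : V) a : (nrm x <= a) = (`|x| <= emb a).
Proof. by rewrite -nrmE le_emb. Qed.

Lemma nrm_ge0 (V : normedZmodType F) (x : V) : 0 <= nrm x.
Proof. by rewrite -emb_ge0 nrmE. Qed.

Lemma nrmD (V : normedZmodType F) (x y : V) : nrm (x + y) <= nrm x + nrm y.
Proof. by rewrite nrm_le rmorphD !nrmE ler_normD. Qed.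

Lemma nrm0 (V : normedZmodType F) : nrm (0 : V) = 0.
Proof. by apply: (fmorph_inj emb); rewrite nrmE normr0 rmorph0. Qed.

Lemma nrm0_eq0 (V : normedZmodType F) (x : V) : nrm x = 0 -> x = 0.
Proof. by move=> x0; apply/eqP; rewrite -normr_eq0 -nrmE x0 rmorph0. Qed.

Lemma nrm_gt0 (V : normedZmodType F) (x : V) : x != 0 -> 0 < nrm x.
Proof. by rewrite -emb_gt0 nrmE normr_gt0. Qed.

Lemma nrmN (V : normedZmodType F) (x : V) : nrm (- x) = nrm x.
Proof. by rewrite /nrm normrN. Qed.

Lemma nrmB (V : normedZmodType F) (x y : V) : nrm x - nrm y <= nrm (x - y).
Proof. by rewrite lerBlDr (le_trans _ (nrmD _ _)) ?subrK. Qed.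

Lemma nrmZ (V : normedModType F) (a : F) (x : V) :
  nrm (a *: x) = nrm a * nrm x.
Proof. by apply: (fmorph_inj emb); rewrite rmorphM !nrmE normrZ. Qed.

Lemma nrmM (a b : F) : nrm (a * b) = nrm a * nrm b.
Proof. by apply: (fmorph_inj emb); rewrite rmorphM !nrmE normrM. Qed.

Lemma nrm_emb a : 0 <= a -> nrm (emb a) = a.
Proof. by move=> a0; rewrite /nrm ger0_norm ?re_emb ?emb_ge0. Qed.

Lemma nrm1 : nrm (1 : F) = 1.
Proof. by rewrite /nrm normr1 re1. Qed.

Lemma nrm_unit (w : F) : nrm w = 1 <-> `|w| = 1.
Proof.
by rewrite -nrmE; split=> [->|/(congr1 re)]; rewrite ?rmorph1 ?re_emb ?re1.
Qed.

Lemma nrm_unitZ (V : normedModType F) (w : F) (x : V) :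
  nrm w = 1 -> nrm (w *: x) = nrm x.
Proof. by move=> w1; rewrite nrmZ w1 mul1r. Qed.

Lemma unit_rotation (a : F) : exists2 w : F, nrm w = 1 & w * a = emb (nrm a).
Proof.
have [->|a0] := eqVneq a 0; first by exists 1; rewrite ?nrm1 // mulr0 nrm0 rmorph0.
exists (`|a| / a); last by rewrite divfK // nrmE.
by apply/nrm_unit; rewrite normf_div normr_id divff // normr_eq0.
Qed.

Lemma unit_factor (a : F) : exists2 w : F, nrm w = 1 & a = w * emb (nrm a).
Proof.
have [w w1 wa] := unit_rotation a; exists w^-1.
  apply/nrm_unit; rewrite normfV; move/nrm_unit: w1 => ->; exact: invr1.
rewrite -wa mulKf //; apply/eqP => w0; move: w1; rewrite w0 nrm0 => /eqP.
by rewrite eq_sym oner_eq0.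
Qed.

(** * The Hahn-Banach theorem *)

Section hahn_banach.
Context (X : normedModType F).

(** Asking for the inequality at every positive [a] already gives equality, by rescaling with the
    inverse of [a]. *)
Definition sublinear (p : X -> R) :=
  (forall x y, p (x + y) <= p x + p y) /\
  (forall a x, 0 < a -> p (emb a *: x) <= a * p x).

Lemma sublinear0 p : sublinear p -> p 0 = 0.
Proof.
move=> [_ pZ].
have := pZ 2 0 (ltr0Sn _ _); have := pZ 2^-1 0; rewrite !scaler0.
by rewrite invr_gt0 ltr0n => /(_ isT) h1 h2; lra.
Qed.

Lemma sublinear_ge p x : sublinear p -> - p (- x) <= p x.
Proof.
move=> sp; have := sublinear0 sp; case: sp => /(_ x (- x)).
by rewrite subrr => h _ p0; lra.
Qed.

Lemma sublinear_nrm : sublinear (@nrm X).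
Proof.
split=> [x y|a x a0]; first exact: nrmD.
by rewrite nrmZ nrm_emb // ltW.
Qed.

(* Lies below p and is at most -p(y) at -y, whereas sublinearity only gives
   p(-y) >= -p(y). *)
Definition tilt (p : X -> R) (y x : X) : R :=
  inf [set p (x + emb t *: y) - t * p y | t in [set t | 0 <= t]].

Lemma tilt_lb p y x t : sublinear p -> 0 <= t ->
  tilt p y x <= p (x + emb t *: y) - t * p y.
Proof.
move=> sp t0; apply: ge_inf; last by exists t.
(* From [s p y <= p (s y) <= p (x + s y) + p (- x)]; this lower bound makes the infimum defining
   [tilt] a genuine one. *)
exists (- p (- x)) => _ [s /= s0 <-].
have h : s * p y <= p (emb s *: y).
  move: s0; rewrite le_eqVlt => /predU1P[<-|s0].
    by rewrite mul0r rmorph0 scale0r sublinear0.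
  have := sp.2 s^-1 (emb s *: y); rewrite invr_gt0 => /(_ s0).
  rewrite scalerA -rmorphM mulVf ?gt_eqF // rmorph1 scale1r.
  by rewrite ler_pdivlMl.
have := sp.1 (x + emb s *: y) (- x); rewrite addrAC subrr add0r.
lra.
Qed.

Lemma tilt_ge p y x m :
  (forall t, 0 <= t -> m <= p (x + emb t *: y) - t * p y) -> m <= tilt p y x.
Proof.
move=> h; apply: lb_le_inf.
  by exists (p (x + emb 0 *: y) - 0 * p y); exists 0 => /=.
by move=> _ [t t0 <-]; exact: h.
Qed.

Lemma tilt_le p y x : sublinear p -> tilt p y x <= p x.
Proof.
move=> sp; have := tilt_lb y x sp (lexx 0).
by rewrite rmorph0 scale0r addr0 mul0r subr0.
Qed.

(** Parameters [t] for [x] and [s] for [z] combine into [t + s] for [x + z], and [t] for [x] becomes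
    [a * t] for [a x]. *)
Lemma sublinear_tilt p y : sublinear p -> sublinear (tilt p y).
Proof.
move=> sp; split=> [x z|a x a0].
  rewrite -lerBlDr; apply: tilt_ge => t t0; rewrite lerBlDr -lerBlDl.
  apply: tilt_ge => s s0; rewrite lerBlDl.
  apply: (le_trans (tilt_lb y _ sp (addr_ge0 t0 s0))).
  have := sp.1 (x + emb t *: y) (z + emb s *: y).
  by rewrite addrACA -scalerDl -rmorphD; lra.
rewrite mulrC -ler_pdivrMr //; apply: tilt_ge => t t0; rewrite ler_pdivrMr //.
have at0 : 0 <= a * t by rewrite mulr_ge0 // ltW.
apply: (le_trans (tilt_lb y _ sp at0)).
have := sp.2 a (x + emb t *: y) a0.
by rewrite scalerDr scalerA -rmorphM; lra.
Qed.

(** Zorn's lemma for the reversed pointwise order, a chain being bounded by its pointwise infimum.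
    Chain members are comparable, so in the proof of subadditivity the smaller of two can serve for
    both arguments. *)
Lemma minimal_sublinear p : sublinear p -> exists q, [/\ sublinear q,
  forall x, q x <= p x &
  forall r, sublinear r -> (forall x, r x <= q x) -> forall x, q x <= r x].
Proof.
move=> sp.
pose T := {q : X -> R | sublinear q /\ forall x, q x <= p x}.
pose below (q r : T) : bool := `[< forall x, proj1_sig r x <= proj1_sig q x >].
pose p' : T := exist _ p (conj sp (fun x => lexx (p x))).
have [||A totA|q qmin] := @ZL_preorder T p' below.
- by move=> q; apply/asboolP.
- move=> r s t /asboolP rs /asboolP st; apply/asboolP => x.
  exact: le_trans (st x) (rs x).
- have [->|/set0P[q0 Aq0]] := eqVneq A set0; first by exists p'.
  pose vals x := [set proj1_sig q x | q in A].
  pose m x := inf (vals x).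
  have mlb q x : A q -> m x <= proj1_sig q x.
    move=> Aq; apply: ge_inf; last by exists q.
    exists (- p (- x)) => _ [r Ar <-].
    case: r {Ar} => r [sr rp] /=; apply: le_trans (sublinear_ge _ sr).
    by rewrite lerN2.
  have mge x c : (forall q, A q -> c <= proj1_sig q x) -> c <= m x.
    move=> h; apply: lb_le_inf; first by exists (proj1_sig q0 x); exists q0.
    by move=> _ [q Aq <-]; exact: h.
  have sm : sublinear m.
    split=> [x y|a x a0].
      rewrite -lerBlDr; apply: (mge) => q Aq; rewrite lerBlDr -lerBlDl.
      apply: (mge) => r Ar; rewrite lerBlDl.
      have [/asboolP rq|/asboolP qr] := totA _ _ Aq Ar.
        apply: (le_trans (mlb r _ Ar)).
        apply: (le_trans ((proj2_sig r).1.1 x y)).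
        by rewrite lerD2r.
      apply: (le_trans (mlb q _ Aq)).
      apply: (le_trans ((proj2_sig q).1.1 x y)).
      by rewrite lerD2l.
    rewrite mulrC -ler_pdivrMr //; apply: (mge) => q Aq; rewrite ler_pdivrMr //.
    rewrite mulrC; apply: (le_trans (mlb q _ Aq)).
    exact: (proj2_sig q).1.2.
  have mp x : m x <= p x.
    exact: le_trans (mlb q0 x Aq0) ((proj2_sig q0).2 x).
  exists (exist _ m (conj sm mp)) => q Aq; apply/asboolP => x.
  exact: mlb.
case: q qmin => q [sq qp] qmin; exists q; split=> // r sr rq.
have rp x : r x <= p x by exact: le_trans (rq x) (qp x).
by have /(_ _)/asboolP := qmin (exist _ r (conj sr rp)); apply; apply/asboolP.
Qed.

(* A minimal sublinear functional is linear, because it cannot be tilted. *)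
Lemma norming_real (x0 : X) : exists u : X -> R, [/\
  forall x y, u (x + y) = u x + u y, forall a x, u (emb a *: x) = a * u x,
  forall x, u x <= nrm x & u x0 = nrm x0].
Proof.
(* Tilting the norm along [x0] first forces [u (- x0) <= - nrm x0], which makes [u] norm [x0]. *)
have [u [su ule umin]] :=
  minimal_sublinear (sublinear_tilt x0 sublinear_nrm).
have u0 := sublinear0 su.
have uD x y : u (x + y) = u x + u y.
  apply/eqP; rewrite eq_le su.1 /=.
  have h := umin _ (sublinear_tilt y su) (fun z => tilt_le y z su) x.
  have := le_trans h (tilt_lb y x su ler01).
  by rewrite rmorph1 scale1r mul1r; lra.
have uN x : u (- x) = - u x by have := uD x (- x); rewrite subrr u0; lra.
have uP a x : 0 < a -> u (emb a *: x) = a * u x.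
  move=> a0; apply/eqP; rewrite eq_le su.2 //=.
  have := su.2 a (- x) a0; rewrite scalerN !uN; lra.
have un x : u x <= nrm x.
  exact: le_trans (ule x) (tilt_le _ _ sublinear_nrm).
exists u; split=> //.
  move=> a x; have [a0|a0|->] := ltgtP a 0; last 2 first.
  - exact: uP.
  - by rewrite rmorph0 scale0r mul0r.
  have := uP (- a) x; rewrite oppr_gt0 => /(_ a0).
  by rewrite rmorphN scaleNr uN; lra.
apply/eqP; rewrite eq_le un /=.
have h := le_trans (ule (- x0)) (tilt_lb x0 (- x0) sublinear_nrm ler01).
by move: h; rewrite rmorph1 scale1r addNr nrm0 uN mul1r; lra.
Qed.

(** For complex scalars [u] is the real part of [f x = u x - j u (j x)]. Rotating [f x] to a
    nonnegative real turns its modulus into a value of [u], so the bound on [u] carries over to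
    [f]. *)
Lemma norming_functional (x0 : X) : exists f : X -> F, [/\
  forall a x y, f (a *: x + y) = a * f x + f y,
  forall x, nrm (f x) <= nrm x & f x0 = emb (nrm x0)].
Proof.
have [u [uD uZ un ux0]] := norming_real x0.
have [f fD [fZ fu]] : exists2 f : X -> F, {morph f : x y / x + y} &
    (forall a x, f (a *: x) = a * f x) /\ forall x, re (f x) = u x.
  have reB a b : re (a - b) = re a - re b.
    by rewrite reD -mulN1r -(rmorph1 emb) -rmorphN re_embM mulN1r.
  case: (re_or_im P) => [real|[j jj im]].
    exists (emb \o u) => [x y|] /=; first by rewrite uD rmorphD.
    split=> [a x|x]; last exact: re_emb.
    by rewrite -{1}(real a) uZ rmorphM real.
  (* The representation of scalars at [z = 1] shows that [j] has real part 0. *)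
  have rej a : re (j * emb a) = 0.
    have h : emb (re 1) - j * emb (re (j * 1)) = 1 by rewrite -im.
    rewrite re1 rmorph1 mulr1 in h.
    have j0 : j != 0.
      by apply/eqP => j0; move/eqP: jj; rewrite j0 mul0r eq_sym oppr_eq0 oner_eq0.
    have : re j = 0.
      apply: (fmorph_inj emb); rewrite rmorph0; apply: (mulfI j0).
      by rewrite mulr0 -[LHS](subKr 1) h subrr.
    by rewrite mulrC re_embM => ->; rewrite mulr0.
  exists (fun x => emb (u x) - j * emb (u (j *: x))) => [x y|].
    by rewrite scalerDr !uD !rmorphD /=; ring.
  split=> [a x|x]; last by rewrite reB re_emb rej subr0.
  set f := fun x => emb (u x) - j * emb (u (j *: x)).
  have fD : {morph f : x y / x + y}.
    by move=> x' y'; rewrite /f scalerDr !uD !rmorphD /=; ring.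
  have fe b y : f (emb b *: y) = emb b * f y.
    rewrite /f (_ : j *: (emb b *: y) = emb b *: (j *: y)) ?uZ ?rmorphM /=.
      by ring.
    by rewrite !scalerA mulrC.
  have fj y : f (j *: y) = j * f y.
    rewrite /f scalerA jj scaleN1r.
    have -> : u (- y) = - u y.
      by rewrite -scaleN1r -(rmorph1 emb) -rmorphN uZ mulN1r.
    rewrite rmorphN mulrBr mulrA jj. ring.
  have fN y : f (- y) = - f y.
    by rewrite -scaleN1r -(rmorph1 emb) -rmorphN fe rmorphN rmorph1 mulN1r.
  rewrite -/(f x) -/(f (a *: x)) (im a) scalerBl fD fN fe -scalerA fj fe.
  by rewrite mulrBl mulrA.
have fn x : nrm (f x) <= nrm x.
  have [w w1 wf] := unit_rotation (f x).
  by rewrite -[leLHS]re_emb -wf -fZ fu -(nrm_unitZ x w1).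
have fx0 : nrm (f x0) = nrm x0.
  apply/eqP; rewrite eq_le fn /= -{1}ux0 -{1}fu -(le_emb P) nrmE; exact: re_le.
(* So far only the modulus of [f x0] is known; a last rotation makes the value itself real and
   nonnegative. *)
have [w w1 wf] := unit_rotation (f x0).
exists (fun x => w * f x); split=> [a x y|x|]; last by rewrite wf fx0.
  by rewrite fD fZ mulrDr mulrCA.
by rewrite nrmM w1 mul1r.
Qed.

End hahn_banach.
End scalars.

(** * Suprema in the scalar field and operator norms *)

Section suprema.
Context {R : realType} {F : numFieldType} (P : real_part R F).
Local Notation emb := (emb P).
Local Notation re := (re P).
Local Notation nrm := (nrm P).

(** An upper bound of [A] is comparable with a real element, hence real itself; so the partial order
    of [F] allows no upper bound incomparable with [emb M]. *)
Lemma supremum_emb (A : set F) (M : R) : (forall a, A a -> a <= emb M) ->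
  (forall e, 0 < e -> exists2 a, A a & emb (M - e) < a) -> supremum 0 A = emb M.
Proof.
move=> ub apx; have [a0 Aa0 _] := apx _ ltr01.
have supM : supremums A (emb M).
  split=> // y uy; have yr : y \is Num.real.
    have ra0 : a0 \is Num.real by rewrite (ler_real (ub _ Aa0)) emb_is_real.
    by rewrite -(ler_real (uy _ Aa0)).
  rewrite -(re_real P yr) le_emb leNgt; apply/negP => yM.
  have [|a Aa] := apx (M - re y); first by rewrite subr_gt0.
  rewrite subKr (re_real P yr) => ya.
  by have := lt_le_trans ya (uy _ Aa); rewrite ltxx.
rewrite /supremum ifF; last by apply/negbTE/set0P; exists a0.
by case: xgetP => [y _ /is_subset1_supremums|/(_ (emb M))//]; exact.
Qed.

(** The condition [M != 0] excludes the default value 0, returned when [A] is empty or has no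
    supremum. *)
Lemma supremum_embP (A : set F) (M : R) : M != 0 ->
  (forall a, A a -> a \is Num.real) -> supremum 0 A = emb M ->
  (forall a, A a -> a <= emb M) /\
  forall e, 0 < e -> exists2 a, A a & emb (M - e) < a.
Proof.
move=> M0 Ar; rewrite /supremum; case: ifPn => [_ /esym/eqP|/set0P[a0 Aa0]].
  by rewrite fmorph_eq0 (negbTE M0).
case: xgetP => [y -> [uy ly] yM|_ /esym/eqP]; last first.
  by rewrite fmorph_eq0 (negbTE M0).
rewrite -yM; split=> // e e0; apply: contrapT => noa.
have /ly : ubound A (emb (M - e)).
  move=> a Aa; rewrite real_leNgt ?emb_is_real ?Ar //; apply/negP => ae.
  by apply: noa; exists a.
by rewrite yM le_emb; lra.
Qed.

Lemma supremum_exists (A : set F) (b : R) : A !=set0 ->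
  (forall a, A a -> a \is Num.real) -> (forall a, A a -> a <= emb b) ->
  exists M, [/\ supremum 0 A = emb M, forall a, A a -> a <= emb M &
    forall e, 0 < e -> exists2 a, A a & emb (M - e) < a].
Proof.
move=> [a0 Aa0] Ar Ab.
have hs : has_sup [set re a | a in A].
  split; first by exists (re a0); exists a0.
  by exists b => _ [a Aa <-]; rewrite -(le_emb P) re_real ?Ab ?Ar.
pose M := sup [set re a | a in A].
have ub a : A a -> a <= emb M.
  move=> Aa; rewrite -(re_real P (Ar _ Aa)) le_emb.
  by apply: sup_upper_bound => //; exists a.
have apx e : 0 < e -> exists2 a, A a & emb (M - e) < a.
  move=> e0; have [_ [a Aa <-]] := sup_adherent e0 hs.
  by exists a => //; rewrite -(re_real P (Ar _ Aa)) lt_emb.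
by exists M; split=> //; exact: supremum_emb.
Qed.

(** A finite lower bound of a nonempty set of norms is real, so the infimum in the partially ordered
    [\bar F] is the real infimum; the default [+oo] fits an empty [A]. *)
Lemma dist_ltP (X : normedModType F) (x : X) (A : set X) (e : R) :
  (dist x A < (emb e)%:E)%E <-> exists2 a, A a & nrm (x - a) < e.
Proof.
rewrite /dist /infimum; split=> [|[a0 Aa0 a0e]].
  case: ifPn => [_|_]; first by rewrite ltEereal.
  case: xgetP => [y -> [_ uy] ye|_]; last by rewrite ltEereal.
  apply: contrapT => noa.
  have /uy : lbound [set (`|x - a|)%:E | a in A] (emb e)%:E.
    move=> _ [a Aa <-]; rewrite lee_fin -(nrmE P) le_emb leNgt.
    by apply/negP => ae; apply: noa; exists a.
  by move=> /(lt_le_trans ye); rewrite ltxx.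
rewrite ifF; last by apply/negbTE/set0P; eexists; exists a0.
set B := [set nrm (x - a) | a in A].
have hB : has_lbound B by exists 0 => _ [a _ <-]; exact: nrm_ge0.
have hi : infimums [set (`|x - a|)%:E | a in A] (emb (inf B))%:E.
  split=> [_ [a Aa <-]|y ly].
    by rewrite lee_fin -(nrmE P) le_emb; apply: ge_inf => //; exists a.
  case: y ly => [r lr| /(_ _ (ex_intro2 _ _ a0 Aa0 erefl))//|_]; last first.
    by rewrite leEereal /= emb_is_real.
  have rr : r \is Num.real.
    have := lr _ (ex_intro2 _ _ a0 Aa0 erefl); rewrite lee_fin => /ler_real ->.
    exact: normr_real.
  rewrite lee_fin -(re_real P rr) le_emb; apply: lb_le_inf.
    by exists (nrm (x - a0)); exists a0.
  move=> _ [a Aa <-]; rewrite -(le_emb P) re_real // nrmE -lee_fin.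
  by apply: lr; exists a.
case: xgetP => [y _ yi|/(_ _ hi)//].
rewrite (is_subset1_infimums yi hi) lte_fin lt_emb.
by apply: le_lt_trans a0e; apply: ge_inf => //; exists a0.
Qed.

End suprema.

Section operators.
Context {R : realType} {F : numFieldType} (P : real_part R F).
Context {X Y : normedModType F}.
Local Notation emb := (emb P).
Local Notation re := (re P).
Local Notation nrm := (nrm P).
Implicit Types (G T : {linear X -> Y}).

Definition opN (T : X -> Y) : R := re (opnorm T).

Lemma unit_ballE (V : normedModType F) (x : V) :
  unit_ball V x = (nrm x <= 1) :> Prop.
Proof. by rewrite nrm_le rmorph1. Qed.

(** Stated for bare functions, because the spear equation applies [opnorm] to
    [fun x => G x + w *: T x], which carries no linear structure. *)
Lemma opnormP (T : X -> Y) (b : R) : (forall x, nrm x <= 1 -> nrm (T x) <= b) ->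
  [/\ opnorm T = emb (opN T), forall x, nrm x <= 1 -> nrm (T x) <= opN T &
  forall e, 0 < e -> exists2 x, nrm x <= 1 & opN T - e < nrm (T x)].
Proof.
move=> Tb.
have [|||M [TM ub apx]] :=
  @supremum_exists R F P [set `|T x| | x in unit_ball X] b.
- by exists `|T 0|; exists 0 => //; rewrite unit_ballE nrm0.
- by move=> _ [x _ <-]; exact: normr_real.
- by move=> _ [x x1 <-]; rewrite -(nrmE P) le_emb Tb // -unit_ballE.
have -> : opN T = M by rewrite /opN /opnorm TM re_emb.
split=> // [x x1|e e0].
  by rewrite nrm_le; apply: ub; exists x => //; rewrite unit_ballE.
have [_ [x x1 <-]] := apx e e0; rewrite -(nrmE P) lt_emb => h.
by exists x => //; rewrite -unit_ballE.
Qed.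

Lemma linear_bounded T : continuous T ->
  exists2 b, 0 <= b & forall x, nrm (T x) <= b * nrm x.
Proof.
move=> cT; have := (linear_boundedP T).1 (continuous_linear_bounded 0 (@cT 0)).
move=> bT; have bT' : \forall r \near +oo, 0 <= r /\ forall x, `|T x| <= r * `|x|.
  by near=> r; split; [near: r; exact: nbhs_pinfty_ge | near: r].
have [r [r0 rT]] := filter_ex bT'; exists (re r).
  by rewrite -(emb_ge0 P) re_real // ger0_real.
by move=> x; rewrite nrm_le rmorphM re_real ?ger0_real // nrmE.
Unshelve. all: by end_near. Qed.

Lemma linear_continuous T b : (forall x, nrm (T x) <= b * nrm x) -> continuous T.
Proof.
move=> Tb; apply: bounded_linear_continuous; apply/linear_boundedP.
near=> r => x; have br : emb b <= r.
  by near: r; apply: nbhs_pinfty_ge; exact: emb_is_real.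
have := Tb x; rewrite nrm_le rmorphM nrmE => /le_trans; apply.
by rewrite ler_wpM2r.
Unshelve. all: by end_near. Qed.

Lemma linear_opnormP T : continuous T ->
  [/\ opnorm T = emb (opN T), forall x, nrm x <= 1 -> nrm (T x) <= opN T &
  forall e, 0 < e -> exists2 x, nrm x <= 1 & opN T - e < nrm (T x)].
Proof.
move=> /linear_bounded[b b0 Tb]; apply: (@opnormP _ b) => x x1.
by apply: le_trans (Tb x) _; rewrite ler_piMr.
Qed.

Lemma opN_ge0 T : continuous T -> 0 <= opN T.
Proof.
case/linear_opnormP => _ h _.
by apply: le_trans (h 0 _); rewrite ?nrm_ge0 ?nrm0.
Qed.

Lemma nrm_opN T x : continuous T -> nrm (T x) <= opN T * nrm x.
Proof.
move=> /linear_opnormP[_ h _].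
have [->|x0] := eqVneq x 0; first by rewrite linear0 !nrm0 mulr0.
have n0 := nrm_gt0 P x0.
have := h (emb (nrm x)^-1 *: x); rewrite linearZ !nrmZ.
rewrite nrm_emb ?invr_ge0 ?nrm_ge0 // mulVf ?gt_eqF // lexx mulrC.
by rewrite ler_pdivrMr //; exact.
Qed.

Lemma opnorm1P G : continuous G -> opnorm G = 1 ->
  (forall x, nrm (G x) <= nrm x) /\
  forall e, 0 < e -> exists2 x, nrm x <= 1 & 1 - e < nrm (G x).
Proof.
move=> cG nG; have G1 : opN G = 1 by rewrite /opN nG re1.
split=> [x|e e0]; first by have := nrm_opN x cG; rewrite G1 mul1r.
by have [_ _ /(_ e e0)] := linear_opnormP cG; rewrite G1.
Qed.

(** The triangle inequality bounds both nested suprema by [1 + opN T], so the equation only asks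
    that this value be approached. Being positive, it cannot be the default 0. *)
Lemma spear_equationP G T : continuous G -> continuous T -> opnorm G = 1 ->
  spear_equation G T <-> forall e, 0 < e -> exists x (w : F),
    [/\ nrm x <= 1, nrm w = 1 & 1 + opN T - e < nrm (G x + w *: T x)].
Proof.
move=> cG cT nG; have [G1 _] := opnorm1P cG nG.
have [TE Tub _] := linear_opnormP cT; have T0 := opN_ge0 cT.
have bnd (w : F) : nrm w = 1 -> forall x, nrm x <= 1 ->
    nrm (G x + w *: T x) <= 1 + opN T.
  move=> w1 x x1; apply: le_trans (nrmD _ _ _) _.
  by rewrite nrm_unitZ // lerD ?Tub // (le_trans (G1 x)).
rewrite /spear_equation TE -(rmorph1 emb) -rmorphD; split=> [S e e0|h].
  have [||ub apx] := supremum_embP (P := P) _ _ S.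
  - by rewrite gt_eqF // ltr_pwDl.
  - move=> _ [w /(nrm_unit P) w1 <-]; have [-> _ _] := opnormP (bnd w w1).
    exact: emb_is_real.
  have e20 : 0 < e / 2 by rewrite divr_gt0.
  have [_ [w /(nrm_unit P) w1 <-]] := apx _ e20.
  have [-> _ apxw] := opnormP (bnd w w1); rewrite lt_emb => hw.
  have [x x1 hx] := apxw _ e20; exists x, w; split=> //; lra.
apply: supremum_emb => [_ [w /(nrm_unit P) w1 <-]|e e0].
  have [-> _ apxw] := opnormP (bnd w w1); rewrite le_emb.
  apply/ler_addgt0Pr => e e0; have [x x1] := apxw _ e0.
  by have := bnd w w1 x x1; lra.
have [x [w [x1 w1 h']]] := h e e0.
exists (opnorm (fun x => G x + w *: T x)).
  by exists w => //; apply/(nrm_unit P).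
have [-> ubw _] := opnormP (bnd w w1); rewrite lt_emb.
exact: lt_le_trans h' (ubw x x1).
Qed.

Lemma spear_setP G : continuous G -> opnorm G = 1 ->
  spear_set (G @` unit_ball X) <-> forall y e, 0 < e -> exists x (w : F),
    [/\ nrm x <= 1, nrm w = 1 & 1 + nrm y - e < nrm (G x + w *: y)].
Proof.
move=> cG nG; have [G1 _] := opnorm1P cG nG.
have bnd x (w : F) y : nrm x <= 1 -> nrm w = 1 -> nrm (G x + w *: y) <= 1 + nrm y.
  move=> x1 w1; apply: le_trans (nrmD _ _ _) _.
  by rewrite nrm_unitZ // lerD2r (le_trans (G1 x)).
rewrite /spear_set; split=> [[_ S] y e e0|h].
  have := S y; rewrite -(nrmE P) -(rmorph1 emb) -rmorphD => Sy.
  have [||ub apx] := supremum_embP (P := P) _ _ Sy.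
  - by rewrite gt_eqF // ltr_pwDl // nrm_ge0.
  - by move=> _ [_ [x _ <-] [w _ <-]]; exact: normr_real.
  have [_ [_ [x x1 <-] [w w1 <-]]] := apx _ e0.
  rewrite -(nrmE P) lt_emb => hx; exists x, w; split=> //.
    by rewrite -unit_ballE.
  exact/nrm_unit.
split=> [_ [x x1 <-]|y].
  by move: x1; rewrite !unit_ballE; exact: le_trans (G1 x).
rewrite -(nrmE P) -(rmorph1 emb) -rmorphD.
apply: supremum_emb => [_ [_ [x x1 <-] [w w1 <-]]|e e0].
  by rewrite -(nrmE P) le_emb bnd -?unit_ballE //; apply/nrm_unit.
have [x [w [x1 w1 h']]] := h y e e0.
exists `|G x + w *: y|; last by rewrite -(nrmE P) lt_emb.
exists (G x); first by exists x => //; rewrite unit_ballE.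
by exists w => //; apply/(nrm_unit P).
Qed.

Lemma spear_equation0 G T : continuous G -> continuous T -> opnorm G = 1 ->
  opN T = 0 -> spear_equation G T.
Proof.
move=> cG cT nG T0; apply/spear_equationP => // e e0.
have [_ /(_ e e0)[x x1 hx]] := opnorm1P cG nG.
exists x, 1; split; rewrite ?nrm1 // T0 addr0 scale1r.
have /nrm0_eq0 -> : nrm (T x) = 0; last by rewrite addr0.
by apply/eqP; rewrite eq_le nrm_ge0 andbT; have := nrm_opN x cT; rewrite T0 mul0r.
Qed.

End operators.

(** * Lushness through finite convex combinations *)

Section lush_finite.
Context {R : realType} {F : numFieldType} (P : real_part R F).
Context {X Y : normedModType F}.
Local Notation emb := (emb P).
Local Notation re := (re P).
Local Notation nrm := (nrm P).

Lemma nrm_sum (V : normedModType F) n (c : 'I_n -> R) (v : 'I_n -> V) :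
  (forall i, 0 <= c i) -> nrm (\sum_i emb (c i) *: v i) <= \sum_i c i * nrm (v i).
Proof.
move=> c0; rewrite nrm_le rmorph_sum (le_trans (ler_norm_sum _ _ _)) //.
by apply: ler_sum => i _; rewrite -(nrmE P) le_emb nrmZ nrm_emb.
Qed.

(* Unlike in the definition of lushness, the norm condition is imposed on a
   single convex combination, with the weights that approximate x0. *)
Definition finitely_lush (G : X -> Y) := forall x0 y e,
  nrm x0 <= 1 -> nrm y = 1 -> 0 < e ->
  exists n (c : 'I_n -> R) (w : 'I_n -> F) (x : 'I_n -> X),
    [/\ forall i, 0 <= c i, \sum_i c i = 1, forall i, nrm (w i) = 1
      & forall i, nrm (x i) <= 1] /\
    (nrm (x0 - \sum_i emb (c i) *: (w i *: x i)) < e /\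
     2 - e < nrm (G (\sum_i emb (c i) *: x i) + y)).

(** A point of [aconv_hull A] near [x0] is a convex combination of rotated elements of [A]; dropping
    the rotations leaves a point of [conv_hull A], where the norm condition holds. *)
Lemma finitely_lush_of_lush (G : {linear X -> Y}) : lush G -> finitely_lush G.
Proof.
move=> [_ L] x0 y e x01 y1 e0.
have [||| A [Aball Aconv Adist]] := L x0 (emb e) y.
- by rewrite (unit_ballE P).
- by rewrite emb_gt0.
- by rewrite /unit_sphere /= -(nrmE P) y1 rmorph1.
have [_ [n [c [v [c0 c1 vA ->]]]] xe] := (dist_ltP P _ _ _).1 Adist.
have /choice[wx wxP] : forall i, exists wx : F * X,
    [/\ nrm wx.1 = 1, A wx.2 & v i = wx.1 *: wx.2].
  move=> i; have [w w1 [x Ax <-]] := vA i.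
  by exists (w, x); split => //; exact/nrm_unit.
have cE i : emb (re (c i)) = c i by rewrite re_real // ger0_real.
have sE (u : 'I_n -> X) : \sum_i emb (re (c i)) *: u i = \sum_i c i *: u i.
  by apply: eq_bigr => i _; rewrite cE.
exists n, (re \o c), (fun i => (wx i).1), (fun i => (wx i).2); split; split.
- by move=> i /=; rewrite -(emb_ge0 P) cE.
- apply: (fmorph_inj emb); rewrite rmorph_sum rmorph1 -c1.
  by apply: eq_bigr => i _; exact: cE.
- by move=> i; have [] := wxP i.
- by move=> i; have [_ /Aball] := wxP i; rewrite (unit_ballE P).
- rewrite sE; move: xe; congr (nrm (x0 - _) < e).
  by apply: eq_bigr => i _; have [_ _ ->] := wxP i.
rewrite sE; have [|_] := Aconv (\sum_i c i *: (wx i).2).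
  by exists n, c, (fun i => (wx i).2); split => // i; have [] := wxP i.
by rewrite -(nrmE P) -(rmorph_nat emb 2) -rmorphB lt_emb.
Qed.

(* With u norming G x + y for the convex combination x of the x_i, the average
   of u (G x_i) is almost 1, so that up to a small weight all x_i lie in one
   slice of u \o G; the remaining ones are moved into that slice. *)
Lemma lush_of_finitely_lush (G : {linear X -> Y}) : continuous G ->
  opnorm G = 1 -> finitely_lush G -> lush G.
Proof.
move=> cG nG L; split=> // x0 e y; rewrite (unit_ballE P) => x01 e0.
move: (e0); rewrite -(re_real P (gtr0_real e0)) emb_gt0.
move: (re e) => {e0}e e0 y1.
have {}y1 : nrm y = 1 by apply: (fmorph_inj emb); rewrite nrmE rmorph1.
have [G1 _] := opnorm1P P cG nG.
(* With tolerance [d * d] the weighted average of the defects [1 - u (G (x i))] is below [d * d], so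
   the points with defect at least [d] have total weight below [d]. *)
have [d [d0 d2 de]] : exists d, [/\ 0 < d, d <= 1/2 & 3 * d < e].
  have [h|h] := leP e 1; first by exists (e/4); split; lra.
  by exists (1/4); split; lra.
have dd0 : 0 < d * d by rewrite mulr_gt0.
have dd : d * d <= d / 2 by rewrite ler_wpM2l //; lra.
have [n [c [w [x [[c0 c1 w1 x1] [xe xy]]]]]] := L x0 y (d * d) x01 y1 dd0.
have [u [uD uZ un uz]] := norming_real P (G (\sum_i emb (c i) *: x i) + y).
have u0 : u 0 = 0 by have := uD 0 0; rewrite addr0; lra.
have usum k (b : 'I_k -> R) (v : 'I_k -> X) :
    u (G (\sum_i emb (b i) *: v i)) = \sum_i b i * u (G (v i)).
  rewrite linear_sum (big_morph u uD u0); apply: eq_bigr => i _.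
  by rewrite linearZ uZ.
have uG v : nrm v <= 1 -> u (G v) <= 1.
  by move=> v1; apply: le_trans (un _) _; exact: le_trans (G1 v) v1.
have uy : u y <= 1 by rewrite -y1.
have uball : u (G (\sum_i emb (c i) *: x i)) <= 1.
  rewrite usum -c1; apply: ler_sum => i _.
  by rewrite ler_piMr // uG.
move: xy; rewrite -uz uD => xy.
have avg : \sum_i c i * (1 - u (G (x i))) < d * d.
  under eq_bigr do rewrite mulrBr mulr1.
  by rewrite sumrB c1 -usum; lra.
have [i0 i0P] : exists i, 1 - d < u (G (x i)).
  apply: contrapT => /forallNP h.
  suff : d <= \sum_i c i * (1 - u (G (x i))) by lra.
  rewrite -[leLHS]mul1r -c1 mulr_suml; apply: ler_sum => i _.
  by rewrite ler_wpM2l //; have /negP := h i; rewrite -leNgt; lra.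
pose a i := if 1 - d < u (G (x i)) then x i else x i0.
have aP i : 1 - d < u (G (a i)) by rewrite /a; case: ifP.
have a1 i : nrm (a i) <= 1 by rewrite /a; case: ifP.
exists (range a); split.
- by move=> _ [i _ <-]; rewrite (unit_ballE P).
- move=> _ [k [b [v [b0 b1 va ->]]]].
  have bE i : b i = emb (re (b i)) by rewrite re_real // ger0_real.
  have b0' i : 0 <= re (b i) by rewrite -(emb_ge0 P) -bE.
  have b1' : \sum_i re (b i) = 1.
    apply: (fmorph_inj emb); rewrite rmorph_sum rmorph1 -b1.
    by apply: eq_bigr => i _; rewrite -bE.
  have -> : \sum_i b i *: v i = \sum_i emb (re (b i)) *: v i.
    by apply: eq_bigr => i _; rewrite -bE.
  split.
    rewrite (unit_ballE P) (le_trans (nrm_sum _ b0')) // -b1'.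
    by apply: ler_sum => i _; rewrite ler_piMr //; have [j _ <-] := va i.
  rewrite /= -(nrmE P) -(rmorph_nat emb 2) -rmorphB lt_emb.
  apply: lt_le_trans (un _); rewrite uD usum.
  suff : 1 - d <= \sum_i re (b i) * u (G (v i)) by lra.
  rewrite -[leLHS]mul1r -{1}b1' mulr_suml; apply: ler_sum => i _.
  by rewrite ler_wpM2l //; have [j _ <-] := va i; exact/ltW/aP.
apply/dist_ltP; exists (\sum_i emb (c i) *: (w i *: a i)).
  exists n, (fun i => emb (c i)), (fun i => w i *: a i); split => //.
  - by move=> i; rewrite emb_ge0.
  - by rewrite -rmorph_sum c1 rmorph1.
  - by move=> i; exists (w i); [exact/(nrm_unit P) | exists (a i) => //; exists i].
set s := \sum_i emb (c i) *: (w i *: x i) in xe.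
rewrite -(subrKA s); apply: le_lt_trans (nrmD _ _ _) _.
suff : nrm (s - \sum_i emb (c i) *: (w i *: a i)) <= 2 * d by lra.
rewrite /s -sumrB; under eq_bigr do rewrite -!scalerBr.
apply: le_trans (nrm_sum _ c0) _.
(* Markov's inequality: a moved point has defect at least [d], so its displacement, at most 2, is at
   most [2 / d] times its defect. *)
apply: (@le_trans _ _ (\sum_i (2 / d) * (c i * (1 - u (G (x i)))))); last first.
  by rewrite -mulr_sumr mulrAC ler_pdivrMr // -mulrA ler_pM2l // ltW.
apply: ler_sum => i _; rewrite nrm_unitZ // mulrCA ler_wpM2l //.
have := uG (x i) (x1 i); rewrite /a; case: ifPn => [_ h|].
  by rewrite subrr nrm0 mulr_ge0 ?subr_ge0 // divr_ge0 // ltW.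
rewrite -leNgt => h _.
have : 2 <= 2 / d * (1 - u (G (x i))).
  by rewrite mulrAC ler_pdivlMr // ler_pM2l //; lra.
apply: le_trans; apply: le_trans (nrmD _ _ _) _.
by rewrite nrmN; have := x1 i; have := x1 i0; lra.
Qed.

End lush_finite.

(** * Spaces of continuous functions *)

(** Used pointwise: a combination of two patched functions with the same outer part is again
    patched, with the inner values combined. *)
Lemma convex_exchange (F : comPzRingType) (V : lmodType F) (a p : F)
    (u v w : V) :
  a *: (p *: u + (1 - p) *: w) + (1 - a) *: (p *: v + (1 - p) *: w) =
  p *: (a *: u + (1 - a) *: v) + (1 - p) *: w.
Proof.
rewrite !scalerDr addrACA !scalerA -scalerDl -mulrDl [a + _]addrC subrK mul1r.
by rewrite ![_ * p]mulrC.
Qed.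

Section cfun_gluing.
Context {R : realType} {F : numFieldType} (P : real_part R F).
Context {K : topologicalType} (cK : compact [set: K]).
Local Notation emb := (emb P).
Local Notation re := (re P).
Local Notation nrm := (nrm P).

Lemma nrm_convex (V : normedModType F) (a m : R) (x y : V) : 0 <= a <= 1 ->
  nrm x <= m -> nrm y <= m -> nrm (emb a *: x + emb (1 - a) *: y) <= m.
Proof.
move=> /andP[a0 a1] xm ym; apply: le_trans (nrmD _ _ _) _.
have -> : m = a * m + (1 - a) * m by ring.
by rewrite !nrmZ !nrm_emb ?subr_ge0 // lerD // ler_wpM2l // subr_ge0.
Qed.

Lemma cfun_nrm_ge (V : normedModType F) (f : cfun cK V) t : nrm (f t) <= nrm f.
Proof. by rewrite nrm_le nrmE; exact: cfun_norm_ge. Qed.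

Lemma cfun_nrm_le (V : normedModType F) (f : cfun cK V) m :
  0 <= m -> (forall t, nrm (f t) <= m) -> nrm f <= m.
Proof.
move=> m0 fm; rewrite nrm_le; apply: cfun_norm_le; rewrite ?emb_ge0 //.
by move=> t; rewrite -nrm_le.
Qed.

Lemma cfun_nrm_max (V : normedModType F) (f : cfun cK V) :
  [set: K] !=set0 -> exists t, nrm f = nrm (f t).
Proof.
move=> [t0 _]; have [s fs _] := cfun_norm_max f t0; exists s.
by apply: (fmorph_inj emb); rewrite !nrmE.
Qed.

Lemma cfun_sumE (V : normedModType F) n (f : 'I_n -> cfun cK V) t :
  (\sum_i f i) t = \sum_i f i t.
Proof. exact: (big_morph (fun g : cfun cK V => g t)). Qed.

Lemma cfun_near (V : normedModType F) (f : cfun cK V) t d : 0 < d ->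
  nbhs t [set s | nrm (f s - f t) <= d].
Proof.
move=> d0; have := @cfun_continuous F K cK V f t.
move=> /cvgrPdist_le/(_ (emb d)); rewrite emb_gt0 => /(_ d0).
by apply: filterS => s /=; rewrite distrC nrm_le.
Qed.

Definition cfun_cst (V : normedModType F) (v : V) : cfun cK V :=
  mkcfun cK (fun t => cvg_cst v).

Lemma cfun_cstE (V : normedModType F) (v : V) t : cfun_cst v t = v.
Proof. by []. Qed.

Lemma nrm_cst (V : normedModType F) (v : V) :
  [set: K] !=set0 -> nrm (cfun_cst v) = nrm v.
Proof. by move=> K0; have [t ->] := cfun_nrm_max (cfun_cst v) K0. Qed.

Lemma emb_continuous : continuous emb.
Proof.
move=> a; apply/cvgrPdist_lt => e e0; rewrite -(re_real P (gtr0_real e0)).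
have re0 : 0 < re e by rewrite -(emb_gt0 P) re_real // gtr0_real.
have := @cvg_id _ (nbhs a); move=> /cvgrPdist_lt/(_ _ re0).
apply: filterS => b; rewrite -rmorphB -(nrmE P) lt_emb.
have [h|/ltW h] := leP 0 (a - b); first by rewrite nrm_emb // ger0_norm.
by rewrite -nrmN -rmorphN nrm_emb ?oppr_ge0 // ler0_norm.
Qed.

Section mix.
Context {phi : K -> R} (cphi : continuous phi).
Context {V : normedModType F}.
Implicit Types f g : cfun cK V.

Lemma cfun_mix_subproof f g :
  continuous (fun t => emb (phi t) *: f t + emb (1 - phi t) *: g t).
Proof.
have ce (psi : K -> R) : continuous psi -> continuous (emb \o psi).
  by move=> cpsi t; apply: continuous_comp; [exact: cpsi | exact: emb_continuous].
move=> t; apply: cvgD; apply: cvgZ.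
- exact: ce.
- exact: cfun_continuous.
- apply: (ce (fun t => 1 - phi t)) => s.
  by apply: cvgB; [exact: cvg_cst | exact: cphi].
- exact: cfun_continuous.
Qed.

Definition cfun_mix f g : cfun cK V := mkcfun cK (@cfun_mix_subproof f g).

Lemma cfun_mixE f g t :
  cfun_mix f g t = emb (phi t) *: f t + emb (1 - phi t) *: g t.
Proof. by []. Qed.

Lemma cfun_mix1 f g t : phi t = 1 -> cfun_mix f g t = f t.
Proof.
move=> p1.
by rewrite cfun_mixE p1 subrr rmorph0 rmorph1 scale1r scale0r addr0.
Qed.

Lemma cfun_mix0 f g t : phi t = 0 -> cfun_mix f g t = g t.
Proof.
move=> p0.
by rewrite cfun_mixE p0 subr0 rmorph0 rmorph1 scale1r scale0r add0r.
Qed.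

Lemma nrm_mix f g m : (forall t, 0 <= phi t <= 1) -> nrm f <= m -> nrm g <= m ->
  nrm (cfun_mix f g) <= m.
Proof.
move=> p01 fm gm; apply: cfun_nrm_le; first exact: le_trans (nrm_ge0 _ _) fm.
move=> t; apply: nrm_convex => //.
  exact: le_trans (cfun_nrm_ge _ _) fm.
exact: le_trans (cfun_nrm_ge _ _) gm.
Qed.

(** Joint linearity in the pair keeps an operator linear when the outer function depends linearly on
    the inner one. *)
Lemma cfun_mix_linear f g f' g' (a : F) :
  cfun_mix (a *: f + f') (a *: g + g') = a *: cfun_mix f g + cfun_mix f' g'.
Proof.
apply: cfunP => t; rewrite cfunDE cfunZE !cfun_mixE !cfunDE !cfunZE.
by rewrite !scalerDr !scalerA ![a * _]mulrC addrACA.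
Qed.

End mix.

(** A compact Hausdorff space is normal, hence completely regular; the function separating [t0] from
    the complement of the interior of [U] is subtracted from 1. *)
Lemma bump_function (hK : hausdorff_space K) t0 (U : set K) : nbhs t0 U ->
  exists phi : K -> R, [/\ continuous phi, forall t, 0 <= phi t <= 1,
    phi t0 = 1 & forall t, ~ U t -> phi t = 0].
Proof.
move=> tU; have creg := @normal_completely_regular R K (compact_normal hK cK)
  (hausdorff_accessible hK).
have [||f [cf f01 f0 f1]] := (@uniform_separatorP K R _ _).1 (creg t0 (~` U°) _ _).
- by apply: open_closedC; exact: open_interior.
- exact.
exists (fun t => 1 - f t); split.
- by move=> t; apply: cvgB; [exact: cvg_cst | exact: cf].
- move=> t; have := f01 (f t); rewrite /= in_itv /=.
  by move=> /(_ (ex_intro2 _ _ t I erefl)); lra.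
- by have /= -> := f0 (f t0) (ex_intro2 _ _ t0 erefl erefl); rewrite subr0.
- move=> t Ut; have /= -> := f1 (f t); rewrite ?subrr //.
  by exists t => // /interior_subset.
Qed.

End cfun_gluing.

Lemma linear_pack (F : numFieldType) (V W : normedModType F) (f : V -> W) :
  linear f -> exists g : {linear V -> W}, g =1 f.
Proof.
move=> lf.
pose g : {linear V -> W} := HB.pack f
  (GRing.isLinear.Build F V W *:%R f lf).
by exists g.
Qed.

(** * From operators on C(K, X) to operators on X *)

Section patching.
Context {R : realType} {F : numFieldType} (P : real_part R F).
Context {K : topologicalType} (K0 : [set: K] !=set0).
Context (cK : compact [set: K]) (hK : hausdorff_space K).
Context {X Y : normedModType F} {G : {linear X -> Y}}.
Context (cG : continuous G) (nG : opnorm G = 1).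
Local Notation emb := (emb P).
Local Notation re := (re P).
Local Notation nrm := (nrm P).
Local Notation opN := (opN P).

Lemma unit_vector : exists v : X, nrm v = 1.
Proof.
have [_ /(_ 1 ltr01)[x x1 hx]] := opnorm1P P cG nG.
have x0 : nrm x != 0.
  apply/eqP => /nrm0_eq0 x0; move: hx.
  by rewrite x0 linear0 nrm0 subrr ltxx.
exists (emb (nrm x)^-1 *: x).
by rewrite nrmZ nrm_emb ?invr_ge0 ?nrm_ge0 // mulVf.
Qed.

(** For nonzero [x] the weight solves [a - (1 - a) = nrm x]; for [x = 0] equal weights on any unit
    vector serve. *)
Lemma unit_direction (x : X) : nrm x <= 1 -> exists (a : R) (u : X),
  [/\ 0 <= a <= 1, nrm u = 1 & x = emb a *: u + emb (1 - a) *: - u].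
Proof.
move=> x1; have [->|x0] := eqVneq x 0.
  have [v v1] := unit_vector; exists (1/2), v; split => //; first lra.
  have -> : 1 - 1/2 = 1/2 :> R by lra.
  by rewrite scalerN subrr.
have n0 := nrm_gt0 P x0.
exists ((1 + nrm x) / 2), (emb (nrm x)^-1 *: x); split; first lra.
  by rewrite nrmZ nrm_emb ?invr_ge0 ?nrm_ge0 // mulVf // gt_eqF.
rewrite scalerN -scaleNr -scalerDl -rmorphN -rmorphD scalerA -rmorphM.
rewrite (_ : _ * _ = 1) ?rmorph1 ?scale1r //.
have -> : (1 + nrm x) / 2 - (1 - (1 + nrm x) / 2) = nrm x by lra.
by rewrite mulfV // gt_eqF.
Qed.

(* If T almost attains its norm at f0, t0, then so does the operator
   x |-> T (phi x + (1 - phi) f(x) f0)(t0) on X, where phi is a bump function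
   at t0 and f is a norming functional. *)
Lemma spear_equation_patch (T : {linear cfun cK X -> cfun cK Y}) :
  continuous T ->
  (forall S : {linear X -> Y}, continuous S -> 0 < opN S ->
    (exists t, forall x, exists f, S x = T f t) -> spear_equation G S) ->
  spear_equation (comp_op cK cG) T.
Proof.
move=> cT H; have cG' := @comp_op_continuous F K cK X Y G cG.
have nG' : opnorm (comp_op cK cG) = 1 by rewrite opnorm_comp_op.
have [N0|N0] := eqVneq (opN T) 0; first exact: (spear_equation0 (P := P)).
have {}N0 : 0 < opN T by rewrite lt_neqAle eq_sym N0 (opN_ge0 P).
apply/(spear_equationP P) => // e e0; set N := opN T in N0 *.
(* The passage from [T] to [S] loses [d] in choosing [f0] and [N * d] in freezing it near [t0]. The
   total stays below [N], so that [opN S] is positive, and within [e / 2]. *)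
have [d [d0 dN de]] :
    exists d, [/\ 0 < d, d * (1 + N) < N & d * (1 + N) <= e / 2].
  have N1 : 0 < 1 + N by lra.
  by have [h|/ltW h] := leP N e; [exists (N / 2 / (1 + N))
    | exists (e / 2 / (1 + N))]; rewrite divfK ?gt_eqF //;
    split; rewrite ?divr_gt0 //; lra.
have [_ _ /(_ d d0)[f0 f01]] := linear_opnormP P cT.
have [t0 ->] := cfun_nrm_max P (T f0) K0; rewrite -/N => Tf0.
have [phi [cphi p01 p1 p0]] := @bump_function R K cK hK _ _ (cfun_near P f0 t0 d0).
have f0t : nrm (f0 t0) <= 1 by exact: le_trans (cfun_nrm_ge _ _ _) f01.
have [a [u [a01 u1 uE]]] := unit_direction f0t.
pose h v := cfun_mix P cphi (cfun_cst cK v) f0.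
(* One of [u] and [- u] works: [f0 - k] is [phi t] times [f0 t - f0 t0], hence of norm at most [d],
   and [T k t0] is a convex combination of the values for [u] and [- u]. *)
have [v v1 Tv] : exists2 v, nrm v = 1 & N - d * (1 + N) < nrm (T (h v) t0).
  apply: contrapT => /forall2NP noT.
  have Th v : nrm v = 1 -> nrm (T (h v) t0) <= N - d * (1 + N).
    by move=> v1; case: (noT v) => [//|/negP]; rewrite -leNgt.
  pose k := emb a *: h u + emb (1 - a) *: h (- u).
  have Tk : nrm (T k t0) <= N - d * (1 + N).
    have -> : T k t0 = emb a *: T (h u) t0 + emb (1 - a) *: T (h (- u)) t0.
      by rewrite /k linearD !linearZ.
    by apply: nrm_convex => //; apply: Th; rewrite ?nrmN.
  have fk : nrm (f0 - k) <= d.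
    apply: cfun_nrm_le; first exact: ltW.
    move=> t; have -> : (f0 - k) t = emb (phi t) *: (f0 t - f0 t0).
      rewrite cfunBE /k cfunDE !cfunZE !cfun_mixE !cfun_cstE.
      rewrite !rmorphB !rmorph1 in uE *; rewrite convex_exchange -uE.
      rewrite scalerBl scale1r scalerBr opprD opprB addrCA.
      by rewrite [f0 t + _]addrC subrK addrC.
    rewrite nrmZ; have /andP[p0' p1'] := p01 t; rewrite nrm_emb //.
    have [/= tU|/p0 ->] := pselect ([set s | nrm (f0 s - f0 t0) <= d] t).
      by rewrite -[leRHS]mul1r ler_pM // nrm_ge0.
    by rewrite mul0r ltW.
  have : nrm (T f0 t0) - nrm (T k t0) <= N * d.
    apply: le_trans (nrmB _ _ _) _; rewrite -cfunBE -linearB.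
    apply: le_trans (cfun_nrm_ge _ _ _) _.
    by apply: le_trans (nrm_opN P _ cT) _; rewrite ler_pM2l.
  lra.
(* The outer part [f x *: f0] makes [Phi] linear, and [f v = 1] gives [Phi v = h v], so [S] inherits
   the large value of [T] at [h v]. *)
have [f [fL fn fv]] := norming_functional P v.
pose Phi x := cfun_mix P cphi (cfun_cst cK x) (f x *: f0).
have PhiL b x y : Phi (b *: x + y) = b *: Phi x + Phi y.
  rewrite /Phi fL -cfun_mix_linear; congr cfun_mix; apply: cfunP => t //.
  by rewrite cfunDE !cfunZE scalerDl scalerA.
have Phin x : nrm (Phi x) <= nrm x.
  apply: nrm_mix => //; first by rewrite nrm_cst.
  rewrite nrmZ; apply: le_trans (fn x); exact: ler_piMr (nrm_ge0 _ _) f01.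
have [S SE] : exists S : {linear X -> Y}, S =1 fun x => T (Phi x) t0.
  by apply: linear_pack => b x y; rewrite PhiL linearP cfunDE cfunZE.
have Sn x : nrm (S x) <= N * nrm x.
  rewrite SE; apply: le_trans (cfun_nrm_ge _ _ _) _.
  by apply: le_trans (nrm_opN P _ cT) _; rewrite ler_pM2l.
have cS := linear_continuous Sn.
have NS : N - d * (1 + N) < opN S.
  have [_ /(_ v) + _] := linear_opnormP P cS; rewrite v1 lexx => /(_ isT).
  apply: lt_le_trans; rewrite SE; move: Tv.
  congr (_ < nrm (T (cfun_mix _ _ _ _) t0)).
  by rewrite fv v1 rmorph1 scale1r.
have e20 : 0 < e / 2 by rewrite divr_gt0.
have [||x [w [x1 w1 hx]]] := (spear_equationP P cG cS nG).1 (H S cS _ _) _ e20.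
- lra.
- by exists t0 => x; exists (Phi x).
exists (Phi x), w; split=> //; first exact: le_trans (Phin x) x1.
apply: lt_le_trans (cfun_nrm_ge P _ t0).
rewrite cfunDE cfunZE comp_opE /Phi cfun_mix1 // cfun_cstE -SE; lra.
Qed.

End patching.

(** * The composition operator *)

Section composition.
Context {R : realType} {F : numFieldType} (P : real_part R F).
Context {K : topologicalType} (K0 : [set: K] !=set0).
Context (cK : compact [set: K]) (hK : hausdorff_space K).
Context {X Y : normedModType F} {G : {linear X -> Y}}.
Context (cG : continuous G) (nG : opnorm G = 1).
Local Notation emb := (emb P).
Local Notation re := (re P).
Local Notation nrm := (nrm P).
Local Notation opN := (opN P).

Let cG' : continuous (comp_op cK cG).
Proof. exact: comp_op_continuous. Qed.

Let nG' : opnorm (comp_op cK cG) = 1.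
Proof. by rewrite opnorm_comp_op. Qed.

(** To test [G] against [T], take the composition operator of [T], which has the same norm, and
    evaluate where the sup norm is attained. The converse is the patching lemma. *)
Lemma spear_operator_comp_op :
  spear_operator (comp_op cK cG) <-> spear_operator G.
Proof.
split=> [S T cT|S T cT]; last first.
  by apply: (spear_equation_patch (P := P) K0 hK cG nG) => // U cU _ _; exact: S.
have cT' := @comp_op_continuous F K cK X Y T cT.
have /(spear_equationP P cG' cT' nG') h := S _ cT'.
apply/(spear_equationP P cG cT nG) => e /h[f [w [f1 w1]]].
have -> : opN (comp_op cK cT) = opN T by apply: (congr1 re); exact: opnorm_comp_op.
have [t -> ft] := cfun_nrm_max P (comp_op cK cG f + w *: comp_op cK cT f) K0.
exists (f t), w; split=> //; exact: le_trans (cfun_nrm_ge _ _ _) f1.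
Qed.

(** * Rank-one operators and the alternative Daugavet property *)

Lemma rank_oneE (V W : normedModType F) (T : {linear V -> W}) : rank_one T ->
  exists2 y, y != 0 & forall x, exists a : F, T x = a *: y.
Proof.
move=> [y y0 Ty]; exists y => // x.
by have : range T (T x) by []; rewrite Ty => -[a _ <-]; exists a.
Qed.

Lemma rank_one_gt0 (V W : normedModType F) (T : {linear V -> W}) :
  continuous T -> rank_one T -> 0 < opN T.
Proof.
move=> cT [y y0 Ty].
have [x _ xy] : range T y by rewrite Ty; exists 1; rewrite ?scale1r.
rewrite lt_neqAle opN_ge0 // andbT; apply/eqP => T0.
have := nrm_opN P x cT; rewrite -T0 mul0r xy => y'.
by have := nrm_gt0 P y0; lra.
Qed.

Lemma rank_oneP (V W : normedModType F) (T : {linear V -> W}) (y : W) :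
  continuous T -> 0 < opN T -> (forall x, exists a : F, T x = a *: y) ->
  rank_one T.
Proof.
move=> cT T0 Ty; have [_ _ /(_ _ T0)[x _]] := linear_opnormP P cT.
rewrite subrr => Tx; have [a Txa] := Ty x.
have y0 : y != 0 by apply/eqP => y0; move: Tx; rewrite Txa y0 scaler0 nrm0 ltxx.
have a0 : a != 0 by apply/eqP => a0; move: Tx; rewrite Txa a0 scale0r nrm0 ltxx.
exists y => //; apply/seteqP; split=> [_ [x' _ <-]|_ [b _ <-]].
  by have [b ->] := Ty x'; exists b.
by exists ((b / a) *: x) => //; rewrite linearZ /= Txa scalerA divfK.
Qed.

(** Patching preserves rank one: the values of [S] are values of [T] at one point [t], hence
    multiples of [g t]. *)
Lemma alternative_Daugavet_comp_op :
  alternative_Daugavet G -> alternative_Daugavet (comp_op cK cG).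
Proof.
move=> A T cT /rank_oneE[g g0 Tg].
apply: (spear_equation_patch (P := P) K0 hK cG nG) => // S cS S0 [t St].
apply: A => //; apply: (rank_oneP (y := g t)) => // x.
by have [f ->] := St x; have [a ->] := Tg f; exists a.
Qed.

(** The bump at an isolated point is its indicator, so [T] lifts to an operator that reads [f t0]
    and returns a function vanishing elsewhere. *)
Lemma alternative_Daugavet_isolated : isolated [set: K] !=set0 ->
  alternative_Daugavet (comp_op cK cG) -> alternative_Daugavet G.
Proof.
move=> [t0 [_ [U tU Ut]]] A T cT rT; have {U tU Ut} t0P : nbhs t0 [set t0].
  by move: Ut; rewrite setIT => <-.
have N0 := rank_one_gt0 cT rT; have [y y0 Ty] := rank_oneE rT.
have [phi [cphi p01 p1 p0]] := @bump_function R K cK hK _ _ t0P.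
pose h (v : Y) := cfun_mix P cphi (cfun_cst cK v) 0.
have hL (b : F) v v' : h (b *: v + v') = b *: h v + h v'.
  rewrite /h -cfun_mix_linear scaler0 addr0; congr cfun_mix.
  exact: cfunP.
have [T' T'E] : exists T' : {linear cfun cK X -> cfun cK Y},
    T' =1 fun f => h (T (f t0)).
  by apply: linear_pack => b f g; rewrite -hL cfunDE cfunZE linearP.
have T'n f : nrm (T' f) <= opN T * nrm f.
  rewrite T'E; apply: nrm_mix => //; last by rewrite nrm0 mulr_ge0 ?nrm_ge0 // ltW.
  rewrite nrm_cst //; apply: le_trans (nrm_opN P _ cT) _.
  by rewrite ler_pM2l // cfun_nrm_ge.
have cT' := linear_continuous T'n.
have NT' : opN T <= opN T'.
  apply/ler_addgt0Pr => d d0; have [_ _ /(_ d d0)[x x1 Tx]] := linear_opnormP P cT.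
  have [_ /(_ (cfun_cst cK x)) + _] := linear_opnormP P cT'.
  rewrite nrm_cst // => /(_ x1); have := cfun_nrm_ge P (T' (cfun_cst cK x)) t0.
  by rewrite T'E /h cfun_mix1 // !cfun_cstE; lra.
have rT' : rank_one T'.
  apply: (rank_oneP (y := h y)) => //; first exact: lt_le_trans NT'.
  move=> f; have [a Ta] := Ty (f t0); exists a.
  rewrite T'E Ta -[a *: y]addr0 hL; apply: etrans (addr0 _); congr (_ + _).
  by apply: cfunP => t; rewrite /h cfun_mixE cfun_cstE cfun0E !scaler0 addr0.
apply/(spear_equationP P cG cT nG) => e e0.
(* The bound [d <= opN T] rules out a norm attained away from [t0], where the sum reduces to
   [G (f t)], of norm at most 1. *)
have [d [d0 de dN]] : exists d, [/\ 0 < d, d <= e & d <= opN T].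
  by have [h1|/ltW h1] := leP e (opN T); [exists e|exists (opN T)].
have [f [w [f1 w1]]] := (spear_equationP P cG' cT' nG').1 (A _ cT' rT') _ d0.
have [t ->] := cfun_nrm_max P (comp_op cK cG f + w *: T' f) K0.
rewrite cfunDE cfunZE comp_opE T'E.
have ft : nrm (f t) <= 1 by exact: le_trans (cfun_nrm_ge _ _ _) f1.
have [->|tt0] := pselect (t = t0).
  rewrite /h cfun_mix1 // cfun_cstE => hf; exists (f t0), w; split=> //; last lra.
  exact: le_trans (cfun_nrm_ge _ _ _) f1.
rewrite /h cfun_mix0 ?p0 // cfun0E scaler0 addr0.
have [/(_ (f t)) h1 _] := opnorm1P P cG nG; lra.
Qed.

(** Testing with [f] mapped to the constant function [l (f t0) *: y] decouples the scalar, read at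
    [t0], from the point [t] where the norm is attained. *)
Lemma spear_set_of_alternative_Daugavet :
  alternative_Daugavet (comp_op cK cG) -> spear_set (G @` unit_ball X).
Proof.
move=> A; apply/(spear_setP P cG nG) => y e e0.
have [->|y0] := eqVneq y 0.
  have [_ /(_ e e0)[x x1 hx]] := opnorm1P P cG nG.
  by exists x, 1; rewrite nrm1 nrm0 addr0 scaler0 addr0.
have [t0 _] := K0; have [v v1] := unit_vector P cG nG.
have [l [lL ln lv]] := norming_functional P v.
have [T TE] : exists T : {linear cfun cK X -> cfun cK Y},
    T =1 fun f => l (f t0) *: cfun_cst cK y.
  apply: linear_pack => b f g.
  by rewrite cfunDE cfunZE lL scalerDl scalerA.
have Tn f : nrm (T f) <= nrm y * nrm f.
  rewrite TE nrmZ nrm_cst // mulrC ler_wpM2l ?nrm_ge0 //.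
  exact: le_trans (ln _) (cfun_nrm_ge _ _ _).
have cT := linear_continuous Tn.
have NT : nrm y <= opN T.
  have [_ /(_ (cfun_cst cK v)) + _] := linear_opnormP P cT.
  rewrite nrm_cst // v1 lexx => /(_ isT); rewrite TE cfun_cstE lv v1 rmorph1.
  by rewrite scale1r nrm_cst.
have rT : rank_one T.
  apply: (rank_oneP (y := cfun_cst cK y)) => //.
    exact: lt_le_trans (nrm_gt0 P y0) NT.
  by move=> f; exists (l (f t0)).
have e20 : 0 < e / 2 by rewrite divr_gt0.
have [f [w [f1 w1]]] := (spear_equationP P cG' cT nG').1 (A _ cT rT) _ e20.
have [t ->] := cfun_nrm_max P (comp_op cK cG f + w *: T f) K0.
rewrite cfunDE cfunZE comp_opE TE cfunZE cfun_cstE scalerA.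
set b := w * l (f t0) => hf.
have ft : nrm (f t) <= 1 by exact: le_trans (cfun_nrm_ge _ _ _) f1.
have b1 : nrm b <= 1.
  rewrite nrmM w1 mul1r; apply: le_trans (ln _) _.
  exact: le_trans (cfun_nrm_ge _ _ _) f1.
(* The scalar [b] only has modulus at most 1. Since [h2] forces [nrm b * nrm y] to be within [e / 2]
   of [nrm y], replacing [b] by its unimodular factor costs less than [e / 2]. *)
have [w' w'1 bE] := unit_factor P b.
have h1 : nrm (G (f t) + b *: y) <=
    nrm (G (f t) + w' *: y) + (nrm y - nrm b * nrm y).
  have -> : G (f t) + b *: y = (G (f t) + w' *: y) + (b - w') *: y.
    by rewrite scalerBl addrACA subrr addr0.
  apply: le_trans (nrmD _ _ _) _; rewrite lerD2l nrmZ.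
  have -> : b - w' = - (w' * emb (1 - nrm b)).
    by rewrite {1}bE rmorphB rmorph1; ring.
  by rewrite nrmN nrmM w'1 nrm_emb ?subr_ge0 // mul1r mulrBl mul1r.
have h2 : nrm (G (f t) + b *: y) <= 1 + nrm b * nrm y.
  apply: le_trans (nrmD _ _ _) _; rewrite nrmZ lerD2r.
  by have [G1 _] := opnorm1P P cG nG; exact: le_trans (G1 _) ft.
by exists (f t), w'; split => //; lra.
Qed.

(** * Perfect K: small open sets that a rank-one operator hardly sees *)

Definition supported_in (V : normedModType F) (U : set K) (f : cfun cK V) :=
  nrm f <= 1 /\ forall t, ~ U t -> f t = 0.

(* Functions supported in disjoint sets can be rotated so that their images
   under a rank-one operator add up, hence one of two disjoint parts of U
   carries at most half of the mass. *)
Lemma rank_one_halving (T : {linear cfun cK X -> cfun cK Y}) (U : set K) m :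
  isolated [set: K] = set0 -> rank_one T -> open U -> U !=set0 ->
  (forall f, supported_in U f -> nrm (T f) <= m) ->
  exists V, [/\ open V, V !=set0, V `<=` U &
    forall f, supported_in V f -> nrm (T f) <= m / 2].
Proof.
move=> noiso /rank_oneE[g g0 Tg] oU [t Ut] TU.
have [t' [Ut' tt']] : exists t', U t' /\ t != t'.
  apply: contrapT => /forallNP h.
  have : isolated [set: K] t; last by rewrite noiso.
  split; first exact: in_setT.
  exists U; first exact: open_nbhs_nbhs.
  rewrite setIT; apply/seteqP; split=> [s Us|_ -> //].
  by apply: contrapT => /eqP st; apply: (h s); split => //; rewrite eq_sym.
have := hK; rewrite open_hausdorff => /(_ t t' tt').
move=> [[A B] /= [/set_mem At /set_mem Bt'] [oA oB /eqP AB]].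
have [hA|/existsNP[f1 /not_implyP[[n1 s1] /negP]]] :=
    pselect (forall f, supported_in (U `&` A) f -> nrm (T f) <= m / 2).
  by exists (U `&` A); split => //; [exact: openI | exists t].
rewrite -ltNge => Tf1.
have [hB|/existsNP[f2 /not_implyP[[n2 s2] /negP]]] :=
    pselect (forall f, supported_in (U `&` B) f -> nrm (T f) <= m / 2).
  by exists (U `&` B); split => //; [exact: openI | exists t'].
rewrite -ltNge => Tf2; exfalso.
have [a1 Ta1] := Tg f1; have [a2 Ta2] := Tg f2.
have [w1 w11 wa1] := unit_rotation P a1; have [w2 w21 wa2] := unit_rotation P a2.
suff : nrm (T f1) + nrm (T f2) <= m by lra.
have -> : nrm (T f1) + nrm (T f2) = nrm (T (w1 *: f1 + w2 *: f2)).
  rewrite linearD !linearZ /= Ta1 Ta2 !scalerA wa1 wa2 -scalerDl -rmorphD.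
  by rewrite !nrmZ nrm_emb ?addr_ge0 ?nrm_ge0 // mulrDl.
apply: TU; split=> [|s Us]; last first.
  by rewrite cfunDE !cfunZE s1 ?s2 ?scaler0 ?addr0 // => -[].
apply: cfun_nrm_le => // s; rewrite cfunDE !cfunZE.
have [As|As] := pselect (A s); last first.
  rewrite s1 => [|[]//]; rewrite scaler0 add0r nrm_unitZ //.
  exact: le_trans (cfun_nrm_ge _ _ _) n2.
rewrite s2; last by move=> [_ Bs]; have : (A `&` B) s by []; rewrite AB.
rewrite scaler0 addr0 nrm_unitZ //.
exact: le_trans (cfun_nrm_ge _ _ _) n1.
Qed.

(** Halving is iterated from the bound [opN T] until the power of 2 exceeds [opN T / d]. *)
Lemma rank_one_negligible (T : {linear cfun cK X -> cfun cK Y}) (U : set K) d :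
  isolated [set: K] = set0 -> continuous T -> rank_one T ->
  open U -> U !=set0 -> 0 < d ->
  exists V, [/\ open V, V !=set0, V `<=` U &
    forall f, supported_in V f -> nrm (T f) <= d].
Proof.
move=> noiso cT rT oU U0 d0.
have h n : exists V, [/\ open V, V !=set0, V `<=` U &
    forall f, supported_in V f -> nrm (T f) <= opN T / 2 ^+ n].
  elim: n => [|n [V [oV V0 VU TV]]].
    exists U; split => // f [f1 _]; rewrite expr0 divr1.
    by have [_ /(_ f f1)] := linear_opnormP P cT.
  have [W [oW W0 WV TW]] := rank_one_halving noiso rT oV V0 TV.
  exists W; split => //; first exact: subset_trans VU.
  by move=> f /TW; rewrite exprSr invfM mulrA.
have [V [oV V0 VU TV]] := h (Num.bound (opN T / d)).
exists V; split => // f /TV /le_trans; apply.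
rewrite ler_pdivrMr ?exprn_gt0 // -ler_pdivrMl // mulrC.
have := archi_boundP (divr_ge0 (opN_ge0 P cT) (ltW d0)) => /ltW/le_trans; apply.
by rewrite -natrX ler_nat ltnW // ltn_expl.
Qed.

Lemma alternative_Daugavet_perfect : isolated [set: K] = set0 ->
  spear_set (G @` unit_ball X) -> alternative_Daugavet (comp_op cK cG).
Proof.
move=> noiso /(spear_setP P cG nG) S T cT rT.
apply/(spear_equationP P cG' cT nG') => e e0.
(* The budget: [d] for the choice of [f0], [d] for the spear set and [3 * d] for replacing [T f0 t0]
   by [T h t1]. *)
have [d d0 de] : exists2 d : R, 0 < d & 5 * d <= e.
  by exists (e / 5); [rewrite divr_gt0 | rewrite mulrC divfK].
have [_ _ /(_ d d0)[f0 f01]] := linear_opnormP P cT.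
have [t0 ->] := cfun_nrm_max P (T f0) K0 => Tf0.
set U := [set s | nrm (T f0 s - T f0 t0) <= d]°.
have [||V [oV [t1 Vt1] VU TV]] := rank_one_negligible noiso cT rT (U := U) _ _ d0.
- exact: open_interior.
- by exists t0; exact: cfun_near.
have {oV} Vnbhs : nbhs t1 V by exact: open_nbhs_nbhs.
have [phi [cphi p01 p1 p0]] := @bump_function R K cK hK _ _ Vnbhs.
have [x [w [x1 w1 hx]]] := S (T f0 t0) d d0.
pose h := cfun_mix P cphi (cfun_cst cK x) f0.
have hn : nrm h <= 1 by apply: nrm_mix => //; rewrite nrm_cst.
(* Half of [h - f0] lies in the unit ball and vanishes off [V], whence the factor 2. *)
have Th : nrm (T h - T f0) <= 2 * d.
  have -> : T h - T f0 = emb 2 *: T (emb (1/2) *: (h - f0)).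
    rewrite linearZ /= scalerA -rmorphM linearB.
    by rewrite (_ : 2 * (1/2) = 1) ?rmorph1 ?scale1r //; lra.
  rewrite nrmZ nrm_emb // ler_pM2l //; apply: TV; split=> [|t Vt].
    rewrite nrmZ nrm_emb ?divr_ge0 //.
    have := nrmD P h (- f0); rewrite nrmN; lra.
  by rewrite cfunZE cfunBE /h cfun_mix0 ?p0 // subrr scaler0.
exists h, w; split=> //; apply: lt_le_trans (cfun_nrm_ge P _ t1).
rewrite cfunDE cfunZE comp_opE /h cfun_mix1 // -/h cfun_cstE.
have Ut1 : nrm (T f0 t1 - T f0 t0) <= d by exact: (interior_subset (VU _ Vt1)).
have Tht : nrm (T h t1 - T f0 t0) <= 3 * d.
  rewrite -(subrKA (T f0 t1)); apply: le_trans (nrmD _ _ _) _.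
  have := cfun_nrm_ge P (T h - T f0) t1; rewrite cfunBE; lra.
suff : nrm (G x + w *: T f0 t0) - nrm (G x + w *: T h t1) <= 3 * d by lra.
apply: le_trans (nrmB _ _ _) _.
rewrite opprD addrACA subrr add0r -scalerBr nrm_unitZ //.
by rewrite -nrmN opprB.
Qed.

(** * Lushness of the composition operator *)

Lemma finitely_lush_comp_op :
  finitely_lush P G <-> finitely_lush P (comp_op cK cG).
Proof.
split=> L.
  move=> f0 g e f01 g1 e0; have [t0] := cfun_nrm_max P g K0.
  rewrite g1 => /esym gt.
  have ft : nrm (f0 t0) <= 1 by exact: le_trans (cfun_nrm_ge _ _ _) f01.
  have e30 : 0 < e / 3 by rewrite divr_gt0.
  have [n [c [w [x [[c0 c1 w1 x1] [xe xy]]]]]] := L _ _ _ ft gt e30.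
  have [phi [cphi p01 p1 p0]] :=
    @bump_function R K cK hK _ _ (cfun_near P f0 t0 e30).
  have w0 i : w i != 0.
    apply/eqP => wi0; have := w1 i; rewrite wi0 nrm0 => /esym/eqP.
    by rewrite oner_eq0.
  (* The outer part [(w i)^-1 *: f0] undoes the rotation, so the rotated average is exactly [f0]
     where [phi] vanishes. *)
  pose h i := cfun_mix P cphi (cfun_cst cK (x i)) ((w i)^-1 *: f0).
  exists n, c, w, h; split; split=> //.
  - move=> i; apply: nrm_mix => //; first by rewrite nrm_cst.
    rewrite nrm_unitZ //; apply/nrm_unit; rewrite normfV.
    by have /(nrm_unit P) -> := w1 i; rewrite invr1.
  (* One third is the distance from [s] to [f0 t0], the other the variation of [f0] near [t0]. *)
  - apply: (@le_lt_trans _ _ (2 * (e / 3))); last by lra.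
    apply: cfun_nrm_le; first by lra.
    move=> t; set s := \sum_i emb (c i) *: (w i *: x i) in xe.
    have -> : (f0 - \sum_i emb (c i) *: (w i *: h i)) t = emb (phi t) *: (f0 t - s).
      rewrite cfunBE cfun_sumE.
      have -> : \sum_i (emb (c i) *: (w i *: h i)) t =
          emb (phi t) *: s + emb (1 - phi t) *: f0 t.
        have -> : emb (1 - phi t) *: f0 t =
            \sum_i emb (c i) *: (emb (1 - phi t) *: f0 t).
          by rewrite -scaler_suml -rmorph_sum c1 rmorph1 scale1r.
        rewrite /s scaler_sumr -big_split; apply: eq_bigr => i _ /=.
        have -> : (emb (c i) *: (w i *: h i)) t = emb (c i) *: (w i *:
            (emb (phi t) *: x i + emb (1 - phi t) *: ((w i)^-1 *: f0 t))) by [].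
        rewrite !scalerDr !scalerA.
        by congr (_ *: _ + _ *: _); [ring | field].
      rewrite rmorphB rmorph1 scalerBl scale1r scalerBr opprD opprB addrCA.
      by rewrite [f0 t + _]addrC subrK addrC.
    rewrite nrmZ; have /andP[p0' p1'] := p01 t; rewrite nrm_emb //.
    have [/= tU|/p0 ->] := pselect ([set s | nrm (f0 s - f0 t0) <= e / 3] t).
      apply: (@le_trans _ _ (nrm (f0 t - s))); first by rewrite ler_piMl ?nrm_ge0.
      rewrite -(subrKA (f0 t0)); apply: le_trans (nrmD _ _ _) _; lra.
    by rewrite mul0r; lra.
  apply: lt_le_trans (cfun_nrm_ge P _ t0).
  rewrite cfunDE comp_opE cfun_sumE.
  have -> : \sum_i (emb (c i) *: h i) t0 = \sum_i emb (c i) *: x i.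
    by apply: eq_bigr => i _; rewrite cfunZE /h cfun_mix1.
  by move: xy; lra.
move=> x0 y e x01 y1 e0.
have [||n [c [w [f [[c0 c1 w1 f1] [fe fy]]]]]] :=
  L (cfun_cst cK x0) (cfun_cst cK y) e _ _ e0.
- by rewrite nrm_cst.
- by rewrite nrm_cst.
move: fy; have [t ->] := cfun_nrm_max P
  (comp_op cK cG (\sum_i emb (c i) *: f i) + cfun_cst cK y) K0.
rewrite cfunDE comp_opE cfun_sumE => fy.
exists n, c, w, (fun i => f i t); split; split=> //.
  by move=> i; exact: le_trans (cfun_nrm_ge _ _ _) (f1 i).
apply: le_lt_trans fe; apply: le_trans (cfun_nrm_ge P _ t).
by rewrite cfunBE cfun_sumE.
Qed.

Lemma lush_comp_op : lush (comp_op cK cG) <-> lush G.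
Proof.
split=> /(finitely_lush_of_lush (P := P)) L;
  apply: (lush_of_finitely_lush (P := P)) => //.
  exact/finitely_lush_comp_op.
exact/finitely_lush_comp_op.
Qed.

End composition.

(** * The real and complex fields, and assembly *)

Lemma real_part_real (R : realType) : inhabited (real_part R R).
Proof.
constructor; apply: (@RealPart R R idfun id) => //; last by left.
exact: ler_norm.
Qed.

Lemma real_part_complex (R : realType) : inhabited (real_part R R[i]).
Proof.
constructor; apply: (@RealPart R R[i] (real_complex R) (@complex.Re R)).
- by move=> [a b] [c d].
- by move=> a [b c] /=; rewrite mul0r subr0.
- move=> z; apply: le_trans (normc_ge_Re z).
  by rewrite lecR; exact: ler_norm.
- exact: RRe_real.
- exact: lecR.
right; exists 'i%C; first by rewrite -expr2 sqr_i.
by move=> z; rewrite ['i%C * z]mulrC ReiNIm rmorphN mulrN opprK -complexE.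
Qed.

Theorem theorem8p5 (R : realType) (F : numFieldType)
    (hF : F = R :> numFieldType \/ F = R[i] :> numFieldType)
    (X Y : completeNormedModType F)
    (K : topologicalType) (K0 : [set: K] !=set0)
    (cK : compact [set: K]) (hK : hausdorff_space K)
    (G : {linear X -> Y}) (cG : continuous G) (nG : opnorm G = 1) :
  [/\ spear_operator (comp_op cK cG) <-> spear_operator G,
      lush (comp_op cK cG) <-> lush G,
      isolated [set: K] !=set0 ->
        (alternative_Daugavet (comp_op cK cG) <-> alternative_Daugavet G)
    & isolated [set: K] = set0 ->
        (alternative_Daugavet (comp_op cK cG) <->
         spear_set (G @` unit_ball X))].
Proof.
have [P] : inhabited (real_part R F).
  by case: hF => ->; [exact: real_part_real | exact: real_part_complex].
split=> [||iso|noiso]; last 2 first.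
- split; first exact: (alternative_Daugavet_isolated P).
  exact: (alternative_Daugavet_comp_op P).
- split; first exact: (spear_set_of_alternative_Daugavet P).
  exact: (alternative_Daugavet_perfect P).
- exact: (spear_operator_comp_op P).
- exact: (lush_comp_op P).
Qed.
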